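(* Let $f\colon\mathbb{D}\to\mathbb{D}$ be holomorphic. Then there exist a holomorphic map $h\colon\mathbb{D}\to\mathbb{D}$ and a sequence $\{\gamma_n\}\subset\mathrm{Aut}(\mathbb{D})$ such that $\gamma_n^{-1}\circ f^n$ converges to $h$ uniformly on compact subsets of $\mathbb{D}$. The map $h$ is unique up to left composition by an automorphism of $\mathbb{D}$: if $h,k\colon\mathbb{D}\to\mathbb{D}$ are holomorphic and $\{\gamma_n\},\{\delta_n\}\subset\mathrm{Aut}(\mathbb{D})$ are such that $\gamma_n^{-1}\circ f^n\to h$ and $\delta_n^{-1}\circ f^n\to k$ uniformly on compact subsets, then there is $\phi\in\mathrm{Aut}(\mathbb{D})$ with $h=\phi\circ k$. Moreover, given $z_0\in\mathbb{D}$, we can choose $\{\gamma_n\}$ (and the corresponding limit $h$) so that $\gamma_n^{-1}\circ f^n(z_0)=h(z_0)=0$ for all $n\in\mathbb{N}$.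
   Context: $\mathbb{D}=\{z\in\mathbb{C} : |z|<1\}$ is the open unit disk; $\mathrm{Aut}(\mathbb{D})$ is the group of biholomorphic self-maps of $\mathbb{D}$; $f^n$ denotes the $n$-th iterate of $f$ (the composition of $f$ with itself $n$ times). *)

(* Defs.v *)
From Stdlib Require Import Reals List.
From Coquelicot Require Import Coquelicot.
Open Scope R_scope.

(* Maps defined on the unit disk are represented by total functions [C -> C],
   of which only the values on [disk] are ever used.  As the disk is open,
   complex differentiability at its points does not depend on the values
   taken outside of it. *)

Definition disk (z : C) : Prop := Cmod z < 1.

Definition holomorphic_on_disk (f : C -> C) : Prop :=
  forall z : C, disk z -> ex_derive (K := C_AbsRing) (V := C_NormedModule) f z.

Definition holo_self_map (f : C -> C) : Prop :=
  (forall z : C, disk z -> disk (f z)) /\ holomorphic_on_disk f.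

(* Biholomorphic self-maps of the disk.  The inverse is part of the data; its
   values on the disk are determined by [aut_fun]. *)
Record aut_disk : Type := AutDisk {
  aut_fun :> C -> C;
  aut_inv : C -> C;
  aut_fun_holo : holo_self_map aut_fun;
  aut_inv_holo : holo_self_map aut_inv;
  aut_funK : forall z : C, disk z -> aut_inv (aut_fun z) = z;
  aut_invK : forall z : C, disk z -> aut_fun (aut_inv z) = z
}.

(* Every open cover has a finite subcover; Stdlib's [compact] is restricted to
   subsets of [R]. *)
Definition compact_set {T : UniformSpace} (K : T -> Prop) : Prop :=
  forall F : (T -> Prop) -> Prop,
    (forall U, F U -> open U) ->
    (forall x, K x -> exists U, F U /\ U x) ->
    exists l : list (T -> Prop),
      (forall U, In U l -> F U) /\
      (forall x, K x -> exists U, In U l /\ U x).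

Definition cvg_unif_compacts_disk (g : nat -> C -> C) (h : C -> C) : Prop :=
  forall K : C -> Prop,
    compact_set K -> (forall z : C, K z -> disk z) ->
    forall eps : R, 0 < eps ->
      exists N : nat, forall n : nat, (N <= n)%nat ->
        forall z : C, K z -> Cmod (g n z - h z)%C < eps.

Definition normalized_iterates (f : C -> C) (gamma : nat -> aut_disk)
  (n : nat) (z : C) : C := aut_inv (gamma n) (Nat.iter n f z).

(* Main.v *)
Require Import Defs.
From Stdlib Require Import Reals Lra Lia List Classical IndefiniteDescription.
From Coquelicot Require Import Coquelicot.
Open Scope R_scope.

(** Write T_c(z) = (z - c) / (1 - conj(c) z), fix the base point z0 and put
    c_n = f^n(z0), u_n = T_(c_n) o f^n.  Then u_n(z0) = 0, and the gamma_n that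
    keep the base point at 0 are exactly those with gamma_n^-1 o f^n = l_n u_n
    for a unimodular l_n, so only the rotations l_n remain to be chosen.

    Existence.  u_(n+1) is the image of u_n under a holomorphic self-map of the
    disk fixing 0, so |u_n(z)| is nonincreasing in n by the Schwarz lemma.  If
    it tends to 0 for every z, the limit is h = 0.  Otherwise |u_n(z1)| >= rho > 0
    for some z1, and l_n is chosen so that g_n = l_n u_n takes a positive value
    r_n at z1.  The map F_n with F_n o g_n = g_(n+1) fixes 0 and sends r_n to
    r_(n+1).  The quotient F_n(w)/w maps the disk to the closed disk and equals
    r_(n+1)/r_n at r_n; by the Schwarz-Pick inequality it is within a multiple of
    1 - r_(n+1)/r_n of the constant 1 ([schwarz_stability]).  Hence
    |g_(n+1)(z) - g_n(z)| <= A (r_n - r_(n+1)) with A independent of n, and the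
    right-hand side telescopes: g_n(z) is a Cauchy sequence
    ([based_limit_exists]).

    Uniqueness.  gamma_n^-1 o delta_n is an automorphism, hence a rotation once
    T_a and T_b are composed on both sides ([automorphism_mob_form]).  So
    A_n = l_n V_n, where A_n = T_(h_n(0)) o h_n and V_n = T_(k_n(0)) o k_n for the
    two normalized sequences h_n and k_n.  The identities
    A_n(z) V_n(w) = A_n(w) V_n(z) and |A_n| = |V_n| pass to the limit without any
    choice of a subsequence, and give A = l V with l unimodular
    ([limit_unique]).

    The function theory behind this is built on complex differentiability at
    each point.  Goursat's theorem on rectangles, pulled back by exp, shows that
    the integrals of f over concentric circles agree; this bounds |f(0)| by the
    maximum of |f| on a circle, and Moebius maps move 0 to any other point
    ([maximum_principle]).  Everything else comes from the maximum principle
    alone.  A function that is only continuous at two points is handled by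
    applying it to (z - e) (z - c) f(z)^n for all n ([maximum_principle_exc]),
    which gives the Schwarz-Pick inequality for functions with an exceptional
    point ([schwarz_pick_exc]), thus for difference quotients.  Its bounds are
    uniform and stable under pointwise limits, so a pointwise limit of self-maps
    is again differentiable ([cdiff_limit]), and the convergence is uniform on
    compact sets ([cvg_unif_compacts_of_pointwise]). *)

(** * Complex differentiability *)

Lemma Cmod_sub_sym (a b : C) : Cmod (a - b) = Cmod (b - a).
Proof. rewrite <- Cmod_opp. f_equal. ring. Qed.

Lemma Cmod_sub_ge (a b : C) : Cmod a - Cmod b <= Cmod (a - b).
Proof.
  pose proof (Cmod_triangle (a - b) b) as H.
  replace (a - b + b)%C with a in H by ring. lra.
Qed.

Lemma Cmod_sub_diag (z : C) : Cmod (z - z) = 0.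
Proof. replace (z - z)%C with (RtoC 0) by ring. apply Cmod_0. Qed.

Lemma Cmod_le_sum (x y : R) : Cmod (x, y) <= Rabs x + Rabs y.
Proof.
  replace ((x, y) : C) with (RtoC x + Ci * RtoC y)%C.
  - eapply Rle_trans; [apply Cmod_triangle|].
    rewrite Cmod_mult, Cmod_Ci, !Cmod_R. lra.
  - unfold Ci, RtoC, Cplus, Cmult; simpl. f_equal; ring.
Qed.

Definition ccont (f : C -> C) (z : C) : Prop :=
  forall eps, 0 < eps -> exists d, 0 < d /\
    forall y, Cmod (y - z) < d -> Cmod (f y - f z) < eps.

(** Caratheodory's form of differentiability: the slope [q] extends continuously
    to [z].  Sums, products and compositions become algebra on slopes, and [q]
    itself is the function to which the Schwarz-Pick inequality is applied
    later. *)
Definition cdiff (f : C -> C) (z : C) : Prop :=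
  exists q : C -> C, ccont q z /\ forall y, (f y - f z = q y * (y - z))%C.

Lemma ccont_continuous (f : C -> C) z :
  ccont f z <->
  @continuous (AbsRing_UniformSpace C_AbsRing) (AbsRing_UniformSpace C_AbsRing) f z.
Proof.
  split.
  - intros H. apply filterlim_locally. intros eps.
    destruct (H eps (cond_pos eps)) as [d [Hd H']].
    exists (mkposreal d Hd). intros y Hy. exact (H' y Hy).
  - intros H eps Heps.
    pose proof (proj1 (filterlim_locally (U := AbsRing_UniformSpace C_AbsRing) f (f z)) H
      (mkposreal eps Heps)) as [d Hd].
    exists d. split; [apply cond_pos|]. intros y Hy. exact (Hd y Hy).
Qed.

Lemma ccont_const a z : ccont (fun _ => a) z.
Proof.
  intros eps He. exists 1. split; [lra|]. intros y _.
  replace (a - a)%C with (RtoC 0) by ring. rewrite Cmod_0. exact He.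
Qed.

Lemma ccont_id z : ccont (fun y => y) z.
Proof. intros eps He. exists eps. auto. Qed.

Lemma ccont_plus f g z :
  ccont f z -> ccont g z -> ccont (fun y => (f y + g y)%C) z.
Proof.
  rewrite !ccont_continuous. intros Hf Hg.
  exact (continuous_plus (U := AbsRing_UniformSpace C_AbsRing)
    (V := AbsRing_NormedModule C_AbsRing) f g z Hf Hg).
Qed.

Lemma ccont_mult f g z :
  ccont f z -> ccont g z -> ccont (fun y => (f y * g y)%C) z.
Proof.
  rewrite !ccont_continuous. intros Hf Hg.
  exact (continuous_mult (U := AbsRing_UniformSpace C_AbsRing) (K := C_AbsRing)
    f g z Hf Hg).
Qed.

Lemma ccont_ext_loc f g z d : 0 < d ->
  (forall y, Cmod (y - z) < d -> f y = g y) -> ccont f z -> ccont g z.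
Proof.
  intros Hd E H eps He. destruct (H eps He) as [d' [Hd' H']].
  exists (Rmin d d'). split; [now apply Rmin_pos|]. intros y Hy.
  rewrite <- !E. apply H'. apply Rlt_le_trans with (1 := Hy), Rmin_r.
  replace (z - z)%C with (RtoC 0) by ring. now rewrite Cmod_0.
  apply Rlt_le_trans with (1 := Hy), Rmin_l.
Qed.

Lemma ccont_minus f g z :
  ccont f z -> ccont g z -> ccont (fun y => (f y - g y)%C) z.
Proof.
  intros Hf Hg. apply ccont_ext_loc with (fun y => (f y + (- (1)) * g y)%C) 1;
    [lra|intros; ring|].
  apply ccont_plus; [exact Hf|]. apply ccont_mult; [apply ccont_const|exact Hg].
Qed.

Lemma ccont_pow f n z : ccont f z -> ccont (fun y => (f y ^ n)%C) z.
Proof.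
  intros Hf. induction n as [|n IH].
  - exact (ccont_const 1 z).
  - exact (ccont_mult _ _ _ Hf IH).
Qed.

Lemma ccont_comp f g z :
  ccont g z -> ccont f (g z) -> ccont (fun y => f (g y)) z.
Proof.
  rewrite !ccont_continuous. intros Hf Hg.
  exact (continuous_comp (U := AbsRing_UniformSpace C_AbsRing)
    (V := AbsRing_UniformSpace C_AbsRing) (W := AbsRing_UniformSpace C_AbsRing)
    g f z Hf Hg).
Qed.

Lemma ccont_inv f z :
  ccont f z -> f z <> RtoC 0 -> ccont (fun y => (/ f y)%C) z.
Proof.
  intros Hf Hz eps He. apply Cmod_gt_0 in Hz as Hm.
  set (m := Cmod (f z)) in *.
  assert (Hmm : 0 < m / 2) by lra.
  assert (He' : 0 < eps * (m * m / 2)) by (apply Rmult_lt_0_compat; nra).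
  destruct (Hf _ Hmm) as [d1 [Hd1 H1]]. destruct (Hf _ He') as [d2 [Hd2 H2]].
  exists (Rmin d1 d2). split; [now apply Rmin_pos|]. intros y Hy.
  specialize (H1 y (Rlt_le_trans _ _ _ Hy (Rmin_l _ _))).
  specialize (H2 y (Rlt_le_trans _ _ _ Hy (Rmin_r _ _))).
  pose proof (Cmod_sub_ge (f z) (f y)) as H3. rewrite Cmod_sub_sym in H3. fold m in H3.
  assert (Hy0 : f y <> RtoC 0) by (apply Cmod_gt_0; lra).
  replace (/ f y - / f z)%C with (- ((f y - f z) / (f y * f z)))%C
    by (field; split; assumption).
  rewrite Cmod_opp, Cmod_div by (now apply Cmult_neq_0). rewrite Cmod_mult. fold m.
  apply Rmult_lt_reg_r with (Cmod (f y) * m); [nra|].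
  unfold Rdiv. rewrite Rmult_assoc, Rinv_l by nra.
  apply Rlt_le_trans with (eps * (m * m / 2)); [lra|].
  apply Rmult_le_compat_l; nra.
Qed.

Lemma cdiff_approx f z :
  cdiff f z <-> exists l : C, forall eps, 0 < eps -> exists d, 0 < d /\
    forall y, Cmod (y - z) < d ->
      Cmod (f y - f z - l * (y - z)) <= eps * Cmod (y - z).
Proof.
  split.
  - intros [q [Hq E]]. exists (q z). intros eps He.
    destruct (Hq eps He) as [d [Hd H]]. exists d. split; [exact Hd|].
    intros y Hy. rewrite E.
    replace (q y * (y - z) - q z * (y - z))%C with ((q y - q z) * (y - z))%C by ring.
    rewrite Cmod_mult. apply Rmult_le_compat_r; [apply Cmod_ge_0|].
    left. now apply H.
  - intros [l H].
    exists (fun y => if Ceq_dec y z then l else ((f y - f z) / (y - z))%C). split.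
    + intros eps He. destruct (H (eps / 2)) as [d [Hd H']]; [lra|].
      exists d. split; [exact Hd|]. intros y Hy.
      destruct (Ceq_dec z z) as [_|n]; [|now elim n].
      destruct (Ceq_dec y z) as [_|Hyz].
      * rewrite Cmod_sub_diag. exact He.
      * assert (Hn : (y - z)%C <> RtoC 0) by now apply Cminus_eq_contra.
        specialize (H' y Hy).
        replace (f y - f z - l * (y - z))%C
          with (((f y - f z) / (y - z) - l) * (y - z))%C in H' by (field; exact Hn).
        rewrite Cmod_mult in H'. apply Cmod_gt_0 in Hn.
        apply Rmult_le_reg_r in H'; lra.
    + intros y. destruct (Ceq_dec y z) as [->|Hyz].
      * ring.
      * field. now apply Cminus_eq_contra.
Qed.

Lemma cdiff_ex_derive f z :
  cdiff f z <-> ex_derive (K := C_AbsRing) (V := C_NormedModule) f z.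
Proof.
  rewrite cdiff_approx. split.
  - intros [l H]. exists l. split.
    + apply is_linear_scal_l.
    + intros x Hx.
      apply (is_filter_lim_locally_unique (K := C_AbsRing)
        (V := AbsRing_NormedModule C_AbsRing)) in Hx.
      subst x. intros eps.
      destruct (H eps (cond_pos eps)) as [d [Hd H']].
      exists (mkposreal d Hd). intros y Hy. specialize (H' y Hy).
      change (Cmod (f y - f z - (y - z) * l) <= eps * Cmod (y - z))%C.
      now rewrite (Cmult_comm (y - z) l).
  - intros [l [_ H]]. exists l. intros eps He.
    destruct (H z (fun P HP => HP) (mkposreal eps He)) as [d Hd].
    exists d. split; [apply cond_pos|]. intros y Hy. specialize (Hd y Hy).
    change (Cmod (f y - f z - (y - z) * l) <= eps * Cmod (y - z))%C in Hd.
    now rewrite (Cmult_comm l).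
Qed.

Lemma cdiff_ccont f z : cdiff f z -> ccont f z.
Proof.
  intros [q [Hq E]].
  apply ccont_ext_loc with (f := fun y => (f z + q y * (y - z))%C) (d := 1); [lra| |].
  - intros y _. rewrite <- E. ring.
  - apply ccont_plus; [apply ccont_const|]. apply ccont_mult; [exact Hq|].
    apply ccont_plus; [apply ccont_id|apply ccont_const].
Qed.

Lemma cdiff_ext_loc f g z d : 0 < d ->
  (forall y, Cmod (y - z) < d -> f y = g y) -> cdiff f z -> cdiff g z.
Proof.
  rewrite !cdiff_approx. intros Hd E [l H]. exists l. intros eps He.
  destruct (H eps He) as [d' [Hd' H']].
  exists (Rmin d d'). split; [now apply Rmin_pos|]. intros y Hy.
  rewrite <- !E.
  - apply H'. apply Rlt_le_trans with (1 := Hy), Rmin_r.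
  - now rewrite Cmod_sub_diag.
  - apply Rlt_le_trans with (1 := Hy), Rmin_l.
Qed.

Lemma cdiff_const a z : cdiff (fun _ => a) z.
Proof.
  exists (fun _ => RtoC 0). split; [apply ccont_const|]. intros y. ring.
Qed.

Lemma cdiff_id z : cdiff (fun y => y) z.
Proof.
  exists (fun _ => RtoC 1). split; [apply ccont_const|]. intros y. ring.
Qed.

Lemma cdiff_plus f g z : cdiff f z -> cdiff g z -> cdiff (fun y => (f y + g y)%C) z.
Proof.
  intros [p [Hp Ef]] [q [Hq Eg]]. exists (fun y => (p y + q y)%C).
  split; [now apply ccont_plus|]. intros y.
  replace (f y + g y - (f z + g z))%C with ((f y - f z) + (g y - g z))%C by ring.
  rewrite Ef, Eg. ring.
Qed.

Lemma cdiff_mult f g z : cdiff f z -> cdiff g z -> cdiff (fun y => (f y * g y)%C) z.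
Proof.
  intros Hf Hg. pose proof (cdiff_ccont g z Hg) as Hc.
  destruct Hf as [p [Hp Ef]], Hg as [q [Hq Eg]].
  exists (fun y => (p y * g y + f z * q y)%C). split.
  - apply ccont_plus; apply ccont_mult; auto. apply ccont_const.
  - intros y.
    replace (f y * g y - f z * g z)%C
      with ((f y - f z) * g y + f z * (g y - g z))%C by ring.
    rewrite Ef, Eg. ring.
Qed.

Lemma cdiff_minus f g z :
  cdiff f z -> cdiff g z -> cdiff (fun y => (f y - g y)%C) z.
Proof.
  intros Hf Hg. apply cdiff_ext_loc with (fun y => (f y + (- (1)) * g y)%C) 1;
    [lra|intros; ring|].
  apply cdiff_plus; [exact Hf|]. apply cdiff_mult; [apply cdiff_const|exact Hg].
Qed.

Lemma cdiff_comp f g z : cdiff g z -> cdiff f (g z) -> cdiff (fun y => f (g y)) z.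
Proof.
  intros Hg Hf. pose proof (cdiff_ccont g z Hg) as Hc.
  destruct Hf as [p [Hp Ef]], Hg as [q [Hq Eg]].
  exists (fun y => (p (g y) * q y)%C). split.
  - apply ccont_mult; [|exact Hq]. now apply (ccont_comp p g).
  - intros y. rewrite Ef, Eg. ring.
Qed.

Lemma ccont_nonzero f z :
  ccont f z -> f z <> RtoC 0 ->
  exists d, 0 < d /\ forall y, Cmod (y - z) < d -> f y <> RtoC 0.
Proof.
  intros Hf Hz. apply Cmod_gt_0 in Hz. destruct (Hf _ Hz) as [d [Hd H]].
  exists d. split; [exact Hd|]. intros y Hy E. specialize (H y Hy).
  rewrite E in H. replace (0 - f z)%C with (- f z)%C in H by ring.
  rewrite Cmod_opp in H. lra.
Qed.

Lemma cdiff_inv f z : cdiff f z -> f z <> RtoC 0 -> cdiff (fun y => (/ f y)%C) z.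
Proof.
  intros Hf Hz. pose proof (cdiff_ccont f z Hf) as Hc.
  destruct (ccont_nonzero f z Hc Hz) as [d [Hd Hn]].
  destruct Hf as [p [Hp E]].
  apply cdiff_ext_loc with (d := d)
    (f := fun y => (/ f z + - / f z * (p y * / f y) * (y - z))%C); [exact Hd| |].
  - intros y Hy.
    replace (- / f z * (p y * / f y) * (y - z))%C
      with (- / f z * / f y * (p y * (y - z)))%C by ring.
    rewrite <- E. field. auto.
  - exists (fun y => (- / f z * (p y * / f y))%C). split.
    + apply ccont_mult; [apply ccont_const|]. apply ccont_mult; [exact Hp|].
      now apply ccont_inv.
    + intros y. ring.
Qed.

Lemma cdiff_pow f n z : cdiff f z -> cdiff (fun y => (f y ^ n)%C) z.
Proof.
  intros Hf. induction n as [|n IH].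
  - exact (cdiff_const 1 z).
  - exact (cdiff_mult _ _ _ Hf IH).
Qed.

(** The source of every removal of an exceptional point below: a zero of the
    factor [y - z] repairs the differentiability that [f] may lack at [z]. *)
Lemma cdiff_mul_vanish f z : ccont f z -> cdiff (fun y => ((y - z) * f y)%C) z.
Proof.
  intros Hf. exists f. split; [exact Hf|]. intros y. ring.
Qed.

(** * Goursat's theorem on rectangles *)

Notation CInt f a b := (RInt (V := C_R_CompleteNormedModule) f a b).
Notation ex_CInt f a b := (ex_RInt (V := C_R_CompleteNormedModule) f a b).

Definition hint (F : C -> C) a b c : C := CInt (fun s => F (s, c)) a b.
Definition vint (F : C -> C) c d a : C := CInt (fun t => F (a, t)) c d.

(** The contour integral of [F] along the boundary of [a, b] x [c, d],
    counterclockwise; [(s, t)] is the complex number s + it. *)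
Definition rect (F : C -> C) a b c d : C :=
  (hint F a b c + Ci * vint F c d b - hint F a b d - Ci * vint F c d a)%C.

Lemma norm_Cmod (z : C_R_CompleteNormedModule) : norm z = Cmod z.
Proof.
  destruct z as [x y].
  change (sqrt (Rabs x ^ 2 + Rabs y ^ 2) = sqrt (x ^ 2 + y ^ 2)).
  now rewrite !pow2_abs.
Qed.

Lemma Cmod_CInt_le (f : R -> C) a b M : a <= b -> ex_CInt f a b ->
  (forall x, a <= x <= b -> Cmod (f x) <= M) -> Cmod (CInt f a b) <= (b - a) * M.
Proof.
  intros Hab Hi HM. rewrite <- norm_Cmod.
  apply (norm_RInt_le_const (V := C_R_CompleteNormedModule) f); [exact Hab| |].
  - intros x Hx. change (norm (f x : C_R_CompleteNormedModule) <= M).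
    rewrite norm_Cmod. auto.
  - now apply RInt_correct.
Qed.

Lemma ex_CInt_cont (f : R -> C) a b : a <= b ->
  (forall x, a <= x <= b -> forall eps, 0 < eps -> exists d, 0 < d /\
     forall y, Rabs (y - x) < d -> Cmod (f y - f x) < eps) ->
  ex_CInt f a b.
Proof.
  intros Hab H. apply (ex_RInt_continuous (V := C_R_CompleteNormedModule)).
  rewrite Rmin_left, Rmax_right by exact Hab. intros x Hx.
  apply filterlim_locally. intros eps.
  destruct (H x Hx eps (cond_pos eps)) as [d [Hd H']].
  exists (mkposreal d Hd). intros y Hy.
  apply C_NormedModule_mixin_compat1. exact (H' y Hy).
Qed.

Lemma Cmod_horizontal (x y c : R) : Cmod ((y, c) - (x, c)) = Rabs (y - x).
Proof.
  replace ((y, c) - (x, c))%C with (RtoC (y - x)); [apply Cmod_R|].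
  unfold RtoC, Cminus, Cplus, Copp; simpl. f_equal; ring.
Qed.

Lemma Cmod_vertical (x y a : R) : Cmod ((a, y) - (a, x)) = Rabs (y - x).
Proof.
  replace ((a, y) - (a, x))%C with (Ci * RtoC (y - x))%C.
  - rewrite Cmod_mult, Cmod_Ci, Cmod_R. ring.
  - unfold Ci, RtoC, Cminus, Cplus, Copp, Cmult; simpl. f_equal; ring.
Qed.

Lemma ex_hint F a b c : a <= b -> (forall s, a <= s <= b -> ccont F (s, c)) ->
  ex_CInt (fun s => F (s, c)) a b.
Proof.
  intros Hab H. apply ex_CInt_cont; [exact Hab|]. intros x Hx eps He.
  destruct (H x Hx eps He) as [d [Hd H']]. exists d. split; [exact Hd|].
  intros y Hy. apply H'. now rewrite Cmod_horizontal.
Qed.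

Lemma ex_vint F c d a : c <= d -> (forall t, c <= t <= d -> ccont F (a, t)) ->
  ex_CInt (fun t => F (a, t)) c d.
Proof.
  intros Hab H. apply ex_CInt_cont; [exact Hab|]. intros x Hx eps He.
  destruct (H x Hx eps He) as [e [Hd H']]. exists e. split; [exact Hd|].
  intros y Hy. apply H'. now rewrite Cmod_vertical.
Qed.

Lemma hint_Chasles F a m b c : a <= m <= b ->
  (forall s, a <= s <= b -> ccont F (s, c)) ->
  hint F a b c = (hint F a m c + hint F m b c)%C.
Proof.
  intros Hm H. symmetry.
  apply (RInt_Chasles (V := C_R_CompleteNormedModule) (fun s => F (s, c)));
    apply ex_hint; try lra; intros; apply H; lra.
Qed.

Lemma vint_Chasles F c m d a : c <= m <= d ->
  (forall t, c <= t <= d -> ccont F (a, t)) ->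
  vint F c d a = (vint F c m a + vint F m d a)%C.
Proof.
  intros Hm H. symmetry.
  apply (RInt_Chasles (V := C_R_CompleteNormedModule) (fun t => F (a, t)));
    apply ex_vint; try lra; intros; apply H; lra.
Qed.

Lemma rect_quarters F a m b c n d : a <= m <= b -> c <= n <= d ->
  (forall s t, a <= s <= b -> c <= t <= d -> ccont F (s, t)) ->
  rect F a b c d =
    (rect F a m c n + rect F m b c n + rect F a m n d + rect F m b n d)%C.
Proof.
  intros Hm Hn H. unfold rect.
  rewrite (hint_Chasles F a m b c), (hint_Chasles F a m b d),
    (vint_Chasles F c n d a), (vint_Chasles F c n d b); auto;
    try (intros; apply H; lra).
  ring.
Qed.

Lemma is_RInt_affine p q a b :
  is_RInt (fun s => p + q * s) a b ((b - a) * (p + q * ((a + b) / 2))).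
Proof.
  replace ((b - a) * (p + q * ((a + b) / 2)))
    with (minus (p * b + q * (b * b / 2)) (p * a + q * (a * a / 2)))
    by (unfold minus, plus, opp; simpl; field).
  apply (is_RInt_derive (fun s => p * s + q * (s * s / 2)) (fun s => p + q * s)).
  - intros x _. auto_derive; [exact I|field].
  - intros x _. apply (ex_derive_continuous (fun s => p + q * s)). auto_derive. exact I.
Qed.

Lemma hint_affine A B a b c :
  hint (fun z => A + B * z)%C a b c =
    (RtoC (b - a) * (A + B * (((a + b) / 2)%R, c)))%C.
Proof.
  apply (is_RInt_unique (V := C_R_CompleteNormedModule)).
  destruct A as [a1 a2], B as [b1 b2].
  unfold RtoC, Cplus, Cmult; simpl.
  apply (is_RInt_fct_extend_pair (U := R_NormedModule) (V := R_NormedModule)); simpl.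
  - apply is_RInt_ext with (fun s => (a1 - b2 * c) + b1 * s).
    + intros s _. match goal with |- @eq _ ?l ?r => change (@eq R l r) end. ring.
    + match goal with |- is_RInt _ _ _ ?v =>
        replace v with ((b - a) * (a1 - b2 * c + b1 * ((a + b) / 2))) by ring end.
      apply is_RInt_affine.
  - apply is_RInt_ext with (fun s => (a2 + b1 * c) + b2 * s).
    + intros s _. match goal with |- @eq _ ?l ?r => change (@eq R l r) end. ring.
    + match goal with |- is_RInt _ _ _ ?v =>
        replace v with ((b - a) * (a2 + b1 * c + b2 * ((a + b) / 2))) by ring end.
      apply is_RInt_affine.
Qed.

Lemma vint_affine A B c d a :
  vint (fun z => A + B * z)%C c d a =
    (RtoC (d - c) * (A + B * (a, ((c + d) / 2)%R)))%C.
Proof.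
  apply (is_RInt_unique (V := C_R_CompleteNormedModule)).
  destruct A as [a1 a2], B as [b1 b2].
  unfold RtoC, Cplus, Cmult; simpl.
  apply (is_RInt_fct_extend_pair (U := R_NormedModule) (V := R_NormedModule)); simpl.
  - apply is_RInt_ext with (fun s => (a1 + b1 * a) + - b2 * s).
    + intros s _. match goal with |- @eq _ ?l ?r => change (@eq R l r) end. ring.
    + match goal with |- is_RInt _ _ _ ?v =>
        replace v with ((d - c) * (a1 + b1 * a + - b2 * ((c + d) / 2))) by ring end.
      apply is_RInt_affine.
  - apply is_RInt_ext with (fun s => (a2 + b2 * a) + b1 * s).
    + intros s _. match goal with |- @eq _ ?l ?r => change (@eq R l r) end. ring.
    + match goal with |- is_RInt _ _ _ ?v =>
        replace v with ((d - c) * (a2 + b2 * a + b1 * ((c + d) / 2))) by ring end.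
      apply is_RInt_affine.
Qed.

Lemma rect_affine A B a b c d : rect (fun z => A + B * z)%C a b c d = RtoC 0.
Proof.
  unfold rect.
  rewrite (hint_affine A B a b c), (hint_affine A B a b d),
    (vint_affine A B c d a), (vint_affine A B c d b).
  destruct A as [a1 a2], B as [b1 b2].
  apply injective_projections; simpl; field.
Qed.

Lemma rect_ext F G a b c d : (forall z, F z = G z) -> rect F a b c d = rect G a b c d.
Proof.
  intros E.
  assert (Hh : forall y, hint F a b y = hint G a b y)
    by (intros; apply (RInt_ext (V := C_R_CompleteNormedModule)); auto).
  assert (Hv : forall x, vint F c d x = vint G c d x)
    by (intros; apply (RInt_ext (V := C_R_CompleteNormedModule)); auto).
  unfold rect. now rewrite (Hh c), (Hh d), (Hv a), (Hv b).
Qed.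

Lemma rect_plus F G a b c d : a <= b -> c <= d ->
  (forall s t, a <= s <= b -> c <= t <= d -> ccont F (s, t)) ->
  (forall s t, a <= s <= b -> c <= t <= d -> ccont G (s, t)) ->
  rect (fun z => F z + G z)%C a b c d = (rect F a b c d + rect G a b c d)%C.
Proof.
  intros Hab Hcd HF HG.
  assert (Hh : forall y, c <= y <= d ->
      hint (fun z => F z + G z)%C a b y = (hint F a b y + hint G a b y)%C).
  { intros y Hy.
    apply (RInt_plus (V := C_R_CompleteNormedModule)
      (fun s => F (s, y)) (fun s => G (s, y))); apply ex_hint; auto. }
  assert (Hv : forall x, a <= x <= b ->
      vint (fun z => F z + G z)%C c d x = (vint F c d x + vint G c d x)%C).
  { intros x Hx.
    apply (RInt_plus (V := C_R_CompleteNormedModule)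
      (fun t => F (x, t)) (fun t => G (x, t))); apply ex_vint; auto. }
  unfold rect. rewrite (Hh c), (Hh d), (Hv a), (Hv b) by lra. ring.
Qed.

Lemma Cmod_rect_le F a b c d M : a <= b -> c <= d ->
  (forall s t, a <= s <= b -> c <= t <= d -> ccont F (s, t)) ->
  (forall s t, a <= s <= b -> c <= t <= d -> Cmod (F (s, t)) <= M) ->
  Cmod (rect F a b c d) <= 2 * ((b - a) + (d - c)) * M.
Proof.
  intros Hab Hcd HF HM.
  assert (Hh : forall y, c <= y <= d -> Cmod (hint F a b y) <= (b - a) * M).
  { intros y Hy. apply Cmod_CInt_le; auto. apply ex_hint; auto. }
  assert (Hv : forall x, a <= x <= b -> Cmod (vint F c d x) <= (d - c) * M).
  { intros x Hx. apply Cmod_CInt_le; auto. apply ex_vint; auto. }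
  pose proof (Hh c ltac:(lra)) as H1. pose proof (Hh d ltac:(lra)) as H2.
  pose proof (Hv a ltac:(lra)) as H3. pose proof (Hv b ltac:(lra)) as H4.
  unfold rect, Cminus.
  eapply Rle_trans; [apply Cmod_triangle|].
  eapply Rle_trans; [apply Rplus_le_compat_r, Cmod_triangle|].
  eapply Rle_trans; [apply Rplus_le_compat_r, Rplus_le_compat_r, Cmod_triangle|].
  rewrite !Cmod_opp, !Cmod_mult, !Cmod_Ci. lra.
Qed.

Lemma nested_intervals (u : nat -> R) (w : nat -> R) :
  (forall n, u n <= u (S n)) -> (forall n, u (S n) + w (S n) <= u n + w n) ->
  (forall n, 0 <= w n) -> exists p, forall n, u n <= p <= u n + w n.
Proof.
  intros Hu Hw H0.
  assert (Hup : forall n k, u n <= u (n + k)%nat).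
  { intros n k. induction k as [|k IH]; [rewrite Nat.add_0_r; lra|].
    rewrite Nat.add_succ_r. apply Rle_trans with (1 := IH), Hu. }
  assert (Hdn : forall n k, u (n + k)%nat + w (n + k)%nat <= u n + w n).
  { intros n k. induction k as [|k IH]; [rewrite Nat.add_0_r; lra|].
    rewrite Nat.add_succ_r. apply Rle_trans with (2 := IH), Hw. }
  assert (Hub : forall n m, u m <= u n + w n).
  { intros n m. apply Rle_trans with (u (m + n)%nat); [apply Hup|].
    apply Rle_trans with (u (m + n)%nat + w (m + n)%nat);
      [specialize (H0 (m + n)%nat); lra|].
    rewrite Nat.add_comm. apply Hdn. }
  destruct (completeness (fun x => exists n, x = u n)) as [p [Hp1 Hp2]].
  - exists (u O + w O). intros x [n ->]. apply Hub.
  - exists (u O). now exists O.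
  - exists p. intros n. split.
    + apply Hp1. now exists n.
    + apply Hp2. intros x [m ->]. apply Hub.
Qed.

(** Bisection in the plane.  All rectangles have sides [alpha * t] and
    [beta * t], so quartering halves [t]; a rectangle violating [P] would
    contain a nested sequence of violating quarters, which shrinks to a point
    [(u, v)] where [P] holds locally. *)
Lemma quarter_induction (P : R -> R -> R -> Prop) (alpha beta : R) :
  0 < alpha -> 0 < beta ->
  (forall a c t, 0 < t ->
     P a c (t / 2) -> P (a + alpha * (t / 2)) c (t / 2) ->
     P a (c + beta * (t / 2)) (t / 2) ->
     P (a + alpha * (t / 2)) (c + beta * (t / 2)) (t / 2) -> P a c t) ->
  (forall u v, exists e, 0 < e /\ forall a c t, 0 < t < e ->
     a <= u <= a + alpha * t -> c <= v <= c + beta * t -> P a c t) ->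
  forall a c t, 0 < t -> P a c t.
Proof.
  intros Ha Hb Hq Hloc a0 c0 t0 Ht0. apply NNPP. intros Hn.
  set (len := fun n => t0 / 2 ^ n).
  assert (Hlen : forall n, 0 < len n).
  { intros n. apply Rdiv_lt_0_compat; [exact Ht0|]. apply pow_lt. lra. }
  assert (HlenS : forall n, len (S n) = len n / 2).
  { intros n. unfold len. simpl. field. apply pow_nonzero. lra. }
  set (Bad := fun n (p : R * R) => ~ P (fst p) (snd p) (len n)).
  assert (Hstep : forall n p, Bad n p -> exists p', Bad (S n) p' /\
    fst p <= fst p' <= fst p + alpha * len (S n) /\
    snd p <= snd p' <= snd p + beta * len (S n)).
  { intros n [x y] Hbad. apply NNPP. intros Hno. apply Hbad. simpl.
    assert (Hl := Hlen (S n)). assert (0 < alpha * len (S n)) by nra.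
    assert (0 < beta * len (S n)) by nra.
    assert (Hall : forall x' y', x <= x' <= x + alpha * len (S n) ->
       y <= y' <= y + beta * len (S n) -> P x' y' (len (S n))).
    { intros x' y' Hx Hy. apply NNPP. intros Hb'. apply Hno.
      exists (x', y'). auto. }
    apply Hq; [apply Hlen| | | |]; rewrite <- HlenS; apply Hall; lra. }
  assert (Hseq : exists p : nat -> R * R, p O = (a0, c0) /\ forall n, Bad n (p n) /\
    fst (p n) <= fst (p (S n)) <= fst (p n) + alpha * len (S n) /\
    snd (p n) <= snd (p (S n)) <= snd (p n) + beta * len (S n)).
  { assert (Hf : forall np : nat * (R * R), exists p', Bad (fst np) (snd np) ->
       Bad (S (fst np)) p' /\
       fst (snd np) <= fst p' <= fst (snd np) + alpha * len (S (fst np)) /\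
       snd (snd np) <= snd p' <= snd (snd np) + beta * len (S (fst np))).
    { intros [n x]. simpl. destruct (classic (Bad n x)) as [Hb'|Hb'].
      - destruct (Hstep n x Hb') as [p' Hp']. now exists p'.
      - exists x. tauto. }
    destruct (functional_choice _ Hf) as [next Hnext].
    set (p := nat_rect (fun _ => (R * R)%type) (a0, c0) (fun n x => next (n, x))).
    assert (HB : forall n, Bad n (p n)).
    { induction n as [|n IH].
      - unfold Bad, len. simpl. now rewrite Rdiv_1_r.
      - exact (proj1 (Hnext (n, p n) IH)). }
    exists p. split; [reflexivity|]. intros n. split; [apply HB|].
    exact (proj2 (Hnext (n, p n) (HB n))). }
  destruct Hseq as [p [Hp0 Hp]].
  destruct (nested_intervals (fun n => fst (p n)) (fun n => alpha * len n)) as [u Hu].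
  - intros n. apply Hp.
  - intros n. destruct (Hp n) as [_ [H _]]. rewrite HlenS in *. lra.
  - intros n. specialize (Hlen n). nra.
  - destruct (nested_intervals (fun n => snd (p n)) (fun n => beta * len n)) as [v Hv].
    + intros n. apply Hp.
    + intros n. destruct (Hp n) as [_ [_ H]]. rewrite HlenS in *. lra.
    + intros n. specialize (Hlen n). nra.
    + destruct (Hloc u v) as [e [He Hsmall]].
      assert (Hex : exists n, len n < e).
      { destruct (Pow_x_infinity 2 ltac:(rewrite Rabs_pos_eq; lra) (t0 / e + 1))
          as [N HN].
        exists N. specialize (HN N (le_n N)).
        rewrite Rabs_pos_eq in HN by (apply pow_le; lra).
        unfold len. apply Rmult_lt_reg_r with (2 ^ N / e).
        - apply Rdiv_lt_0_compat; [apply pow_lt; lra|exact He].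
        - replace (e * (2 ^ N / e)) with (2 ^ N) by (field; lra).
          replace (t0 / 2 ^ N * (2 ^ N / e)) with (t0 / e);
            [lra|field; split; [lra|apply pow_nonzero; lra]]. }
      destruct Hex as [n Hlt]. destruct (Hp n) as [Hbad _]. apply Hbad.
      apply Hsmall; [split; [apply Hlen|exact Hlt]|apply Hu|apply Hv].
Qed.

(** With the aspect ratio fixed, the bound eps * t^2 is additive under
    quartering, and it holds for small rectangles around any point: there [F] is
    an affine function, whose contour integral vanishes, up to an error
    o(t) integrated over a boundary of length O(t). *)
Theorem goursat F a b c d : a < b -> c < d ->
  (forall s t, a <= s <= b -> c <= t <= d -> cdiff F (s, t)) ->
  rect F a b c d = RtoC 0.
Proof.
  intros Hab Hcd HF.
  set (alpha := b - a). set (beta := d - c).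
  assert (Ha : 0 < alpha) by (unfold alpha; lra).
  assert (Hb : 0 < beta) by (unfold beta; lra).
  assert (Hmain : forall eps, 0 < eps -> Cmod (rect F a b c d) <= eps).
  { intros eps Heps.
    set (P := fun x y t => a <= x -> x + alpha * t <= b -> c <= y -> y + beta * t <= d ->
      Cmod (rect F x (x + alpha * t) y (y + beta * t)) <= eps * (t * t)).
    assert (HP : P a c 1).
    { apply (quarter_induction P alpha beta Ha Hb); [| |lra].
      - intros x y t Ht H1 H2 H3 H4 Hxa Hxb Hyc Hyd.
        assert (0 < alpha * (t / 2)) by (apply Rmult_lt_0_compat; lra).
        assert (0 < beta * (t / 2)) by (apply Rmult_lt_0_compat; lra).
        rewrite (rect_quarters F x (x + alpha * (t / 2)) (x + alpha * t)
          y (y + beta * (t / 2)) (y + beta * t)); try lra.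
        2:{ intros s r Hs Hr. apply cdiff_ccont, HF; lra. }
        replace (x + alpha * t) with (x + alpha * (t / 2) + alpha * (t / 2)) by field.
        replace (y + beta * t) with (y + beta * (t / 2) + beta * (t / 2)) by field.
        specialize (H1 ltac:(lra) ltac:(lra) ltac:(lra) ltac:(lra)).
        specialize (H2 ltac:(lra) ltac:(lra) ltac:(lra) ltac:(lra)).
        specialize (H3 ltac:(lra) ltac:(lra) ltac:(lra) ltac:(lra)).
        specialize (H4 ltac:(lra) ltac:(lra) ltac:(lra) ltac:(lra)).
        eapply Rle_trans; [apply Cmod_triangle|].
        eapply Rle_trans; [apply Rplus_le_compat_r, Cmod_triangle|].
        eapply Rle_trans; [apply Rplus_le_compat_r, Rplus_le_compat_r, Cmod_triangle|].
        lra.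
      - intros u v.
        destruct (classic (a <= u <= b /\ c <= v <= d)) as [[Hu Hv]|Hout].
        2:{ exists 1. split; [lra|]. intros x y t Ht Hxu Hyv Hxa Hxb Hyc Hyd.
            exfalso. apply Hout. lra. }
        pose proof (HF u v Hu Hv) as Hd.
        destruct (proj1 (cdiff_approx F (u, v)) Hd) as [l Hl].
        (* perimeter times diameter of a cell is at most K * t^2 *)
        set (K := 2 * ((alpha + beta) * (alpha + beta))).
        assert (HK : 0 < K) by (unfold K; nra).
        destruct (Hl (eps / K)) as [e [He H']]; [now apply Rdiv_lt_0_compat|].
        exists (e / (alpha + beta)). split; [apply Rdiv_lt_0_compat; lra|].
        intros x y t [Ht Hte] Hxu Hyv Hxa Hxb Hyc Hyd.
        assert (Hat : 0 < alpha * t) by now apply Rmult_lt_0_compat.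
        assert (Hbt : 0 < beta * t) by now apply Rmult_lt_0_compat.
        assert (Hsmall : (alpha + beta) * t < e).
        { apply Rmult_lt_reg_r with (/ (alpha + beta)); [apply Rinv_0_lt_compat; lra|].
          replace ((alpha + beta) * t * / (alpha + beta)) with t by (field; lra).
          exact Hte. }
        set (A := (F (u, v) - l * (u, v))%C).
        set (E := fun z => (F z - F (u, v) - l * (z - (u, v)))%C).
        assert (Hcr : forall s r, x <= s <= x + alpha * t -> y <= r <= y + beta * t ->
           ccont F (s, r)).
        { intros s r Hs Hr. apply cdiff_ccont, HF; lra. }
        assert (HcE : forall s r, x <= s <= x + alpha * t -> y <= r <= y + beta * t ->
           ccont E (s, r)).
        { intros s r Hs Hr. unfold E, Cminus.
          repeat first [apply ccont_plus | apply ccont_const | now apply Hcr].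
          apply ccont_ext_loc with (fun z => - (l * (z + - (u, v))))%C 1; [lra|auto|].
          apply ccont_ext_loc with (fun z => - l * (z + - (u, v)))%C 1;
            [lra|intros; ring|].
          apply ccont_mult; [apply ccont_const|].
          apply ccont_plus; [apply ccont_id|apply ccont_const]. }
        assert (Erect : rect F x (x + alpha * t) y (y + beta * t)
                        = rect E x (x + alpha * t) y (y + beta * t)).
        { rewrite (rect_ext F (fun z => (A + l * z) + E z)%C)
            by (intros z; unfold E, A; ring).
          rewrite rect_plus; try lra; auto.
          - rewrite rect_affine. ring.
          - intros s r _ _. apply ccont_plus; [apply ccont_const|].
            apply ccont_mult; [apply ccont_const|apply ccont_id]. }
        rewrite Erect.
        eapply Rle_trans.
        { apply Cmod_rect_le with (M := eps / K * ((alpha + beta) * t)); try lra.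
          - exact HcE.
          - intros s r Hs Hr.
            assert (Hdist : Cmod ((s, r) - (u, v)) <= (alpha + beta) * t).
            { apply Rle_trans with (Rabs (s - u) + Rabs (r - v)).
              - apply (Cmod_le_sum (s - u) (r - v)).
              - assert (Rabs (s - u) <= alpha * t) by (apply Rabs_le; lra).
                assert (Rabs (r - v) <= beta * t) by (apply Rabs_le; lra). lra. }
            eapply Rle_trans; [apply H'; lra|].
            apply Rmult_le_compat_l; [|exact Hdist].
            left. now apply Rdiv_lt_0_compat. }
        right. unfold K. field. lra. }
    unfold P in HP.
    replace (a + alpha * 1) with b in HP by (unfold alpha; ring).
    replace (c + beta * 1) with d in HP by (unfold beta; ring).
    specialize (HP ltac:(lra) ltac:(lra) ltac:(lra) ltac:(lra)). lra. }
  apply Cmod_eq_0. apply Rle_antisym; [|apply Cmod_ge_0].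
  apply le_epsilon. intros eps He. rewrite Rplus_0_l. auto.
Qed.

(** * The maximum principle *)

Definition cexp (z : C) : C := (RtoC (exp (fst z)) * (cos (snd z), sin (snd z)))%C.

Lemma Cmod_cexp z : Cmod (cexp z) = exp (fst z).
Proof.
  unfold cexp. rewrite Cmod_mult, Cmod_R, Rabs_pos_eq by (left; apply exp_pos).
  replace (Cmod (cos (snd z), sin (snd z))) with 1; [ring|].
  unfold Cmod; simpl fst; simpl snd.
  replace (cos (snd z) ^ 2 + sin (snd z) ^ 2) with 1.
  - now rewrite sqrt_1.
  - pose proof (sin2_cos2 (snd z)) as H. unfold Rsqr in H. lra.
Qed.

Lemma cexp_plus z w : cexp (z + w) = (cexp z * cexp w)%C.
Proof.
  destruct z as [x y], w as [u v]. unfold cexp. simpl fst; simpl snd.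
  rewrite exp_plus, cos_plus, sin_plus.
  apply injective_projections; simpl; ring.
Qed.

Lemma derive_approx_0 (f : R -> R) l : is_derive f 0 l ->
  forall eps, 0 < eps -> exists d, 0 < d /\
    forall x, Rabs x < d -> Rabs (f x - f 0 - l * x) <= eps * Rabs x.
Proof.
  intros H eps He. destruct H as [_ H].
  destruct (H 0 (fun P HP => HP) (mkposreal eps He)) as [d Hd].
  exists d. split; [apply cond_pos|]. intros x Hx.
  assert (Hb : ball 0 d x).
  { change (Rabs (x - 0) < d). now rewrite Rminus_0_r. }
  specialize (Hd x Hb).
  change (Rabs (f x - f 0 - (x - 0) * l) <= eps * Rabs (x - 0)) in Hd.
  rewrite Rminus_0_r in Hd. now rewrite (Rmult_comm l).
Qed.

Lemma cexp_approx_0 eps : 0 < eps -> exists d, 0 < d /\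
  forall z, Cmod z < d -> Cmod (cexp z - 1 - z) <= eps * Cmod z.
Proof.
  intros He.
  (* the error splits below into three terms of total size at most 6 e |z| *)
  set (e := Rmin 1 (eps / 8)).
  assert (Hepos : 0 < e) by (apply Rmin_pos; lra).
  assert (He1 : e <= 1) by apply Rmin_l. assert (He8 : e <= eps / 8) by apply Rmin_r.
  assert (De : is_derive exp 0 1) by (auto_derive; [exact I|rewrite exp_0; ring]).
  assert (Dc : is_derive cos 0 0) by (auto_derive; [exact I|rewrite sin_0; ring]).
  assert (Ds : is_derive sin 0 1) by (auto_derive; [exact I|rewrite cos_0; ring]).
  destruct (derive_approx_0 _ _ De e Hepos) as [d1 [Hd1 H1]].
  destruct (derive_approx_0 _ _ Dc e Hepos) as [d2 [Hd2 H2]].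
  destruct (derive_approx_0 _ _ Ds e Hepos) as [d3 [Hd3 H3]].
  rewrite exp_0 in H1. rewrite cos_0 in H2. rewrite sin_0 in H3.
  set (d := Rmin (Rmin d1 d2) (Rmin d3 e)).
  exists d. split; [repeat apply Rmin_pos; lra|].
  intros [s t] Hz. set (m := Cmod (s, t)) in *.
  assert (Hm0 : 0 <= m) by apply Cmod_ge_0.
  pose proof (Rmax_Cmod (s, t)) as Hmx. simpl in Hmx. fold m in Hmx.
  assert (Hs : Rabs s <= m) by (eapply Rle_trans; [apply Rmax_l|exact Hmx]).
  assert (Ht : Rabs t <= m) by (eapply Rle_trans; [apply Rmax_r|exact Hmx]).
  assert (Hmd : m < d1 /\ m < d2 /\ m < d3 /\ m < e).
  { unfold d in Hz. repeat split; eapply Rlt_le_trans; try exact Hz;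
    eauto using Rmin_l, Rmin_r, Rle_trans. }
  destruct Hmd as (M1 & M2 & M3 & Me).
  specialize (H1 s ltac:(lra)). specialize (H2 t ltac:(lra)). specialize (H3 t ltac:(lra)).
  set (x := exp s - 1 - 1 * s) in *. set (c := cos t - 1 - 0 * t) in *.
  set (r := sin t - 0 - 1 * t) in *.
  assert (Hc1 : Rabs c <= e * m) by nra.
  assert (Hr1 : Rabs r <= e * m) by nra.
  assert (Hx1 : Rabs x <= e * m) by nra.
  unfold cexp. simpl fst; simpl snd.
  assert (Hmodcs : Cmod (cos t, sin t) = 1).
  { pose proof (Cmod_cexp (0, t)) as H. unfold cexp in H. simpl fst in H.
    simpl snd in H. rewrite exp_0 in H. now rewrite Cmult_1_l in H. }
  replace (RtoC (exp s) * (cos t, sin t) - 1 - (s, t))%C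
    with (RtoC x * (cos t, sin t) + RtoC (1 + s) * (c, r) + (0, (s * t)%R))%C.
  2:{ apply injective_projections; simpl; unfold x, c, r; ring. }
  eapply Rle_trans; [apply Cmod_triangle|].
  eapply Rle_trans; [apply Rplus_le_compat_r, Cmod_triangle|].
  rewrite !Cmod_mult, Hmodcs, !Cmod_R.
  assert (A1 : Rabs (1 + s) <= 2).
  { eapply Rle_trans; [apply Rabs_triang|]. rewrite Rabs_R1. lra. }
  assert (A2 : Cmod (c, r) <= 2 * (e * m)).
  { eapply Rle_trans; [apply Cmod_le_sum|]. lra. }
  assert (A3 : Cmod (0, s * t) <= e * m).
  { eapply Rle_trans; [apply Cmod_le_sum|]. rewrite Rabs_R0, Rabs_mult.
    assert (Rabs s * Rabs t <= e * m)
      by (apply Rmult_le_compat; try apply Rabs_pos; lra). lra. }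
  pose proof (Cmod_ge_0 (c, r)). pose proof (Rabs_pos (1 + s)). nra.
Qed.

Lemma cdiff_cexp z : cdiff cexp z.
Proof.
  apply cdiff_approx. exists (cexp z). intros eps He.
  assert (Hp : 0 < Cmod (cexp z)) by (rewrite Cmod_cexp; apply exp_pos).
  destruct (cexp_approx_0 (eps / Cmod (cexp z))) as [d [Hd H]];
    [now apply Rdiv_lt_0_compat|].
  exists d. split; [exact Hd|]. intros y Hy. specialize (H (y - z)%C Hy).
  replace (cexp y) with (cexp z * cexp (y - z))%C
    by (rewrite <- cexp_plus; f_equal; ring).
  replace (cexp z * cexp (y - z) - cexp z - cexp z * (y - z))%C
    with (cexp z * (cexp (y - z) - 1 - (y - z)))%C by ring.
  rewrite Cmod_mult.
  apply Rle_trans with (Cmod (cexp z) * (eps / Cmod (cexp z) * Cmod (y - z))).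
  - apply Rmult_le_compat_l; lra.
  - right. field. lra.
Qed.

Lemma disk_0 : disk (RtoC 0).
Proof. unfold disk. rewrite Cmod_0. lra. Qed.

(** In the coordinates z = exp(s + it) two concentric circles become two
    sides of a rectangle whose other two sides carry the same values of
    [f (cexp z)], by periodicity; so Goursat's theorem leaves equality of the
    integrals over the circles. *)
Lemma circle_integral_const f a b : a < b -> b < 0 ->
  (forall z, disk z -> cdiff f z) ->
  vint (fun z => f (cexp z)) 0 (2 * PI) a = vint (fun z => f (cexp z)) 0 (2 * PI) b.
Proof.
  intros Hab Hb Hf. set (F := fun z => f (cexp z)).
  assert (HF : forall s t, s < 0 -> cdiff F (s, t)).
  { intros s t Hs. apply (cdiff_comp f cexp); [apply cdiff_cexp|].
    apply Hf. unfold disk. rewrite Cmod_cexp. simpl.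
    rewrite <- exp_0. now apply exp_increasing. }
  assert (HPI : 0 < 2 * PI) by (pose proof PI_RGT_0; lra).
  pose proof (goursat F a b 0 (2 * PI) Hab HPI) as HG.
  rewrite <- (Cplus_0_r (vint F 0 (2 * PI) a)).
  assert (Hper : hint F a b (2 * PI) = hint F a b 0).
  { apply (RInt_ext (V := C_R_CompleteNormedModule)). intros s _. unfold F, cexp.
    simpl fst; simpl snd. now rewrite cos_2PI, sin_2PI, cos_0, sin_0. }
  assert (H0 : rect F a b 0 (2 * PI) = RtoC 0).
  { apply HG. intros s t Hs _. apply HF. lra. }
  unfold rect in H0. rewrite Hper in H0.
  apply (f_equal (fun z => (- Ci * z)%C)) in H0.
  replace (- Ci * (hint F a b 0 + Ci * vint F 0 (2 * PI) b - hint F a b 0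
     - Ci * vint F 0 (2 * PI) a))%C
    with (- (Ci * Ci) * (vint F 0 (2 * PI) b - vint F 0 (2 * PI) a))%C in H0 by ring.
  replace (Ci * Ci)%C with (- RtoC 1)%C in H0
    by (apply injective_projections; simpl; ring).
  replace (vint F 0 (2 * PI) b)
    with (vint F 0 (2 * PI) a + - - RtoC 1 * (vint F 0 (2 * PI) b - vint F 0 (2 * PI) a))%C
    by ring.
  rewrite H0. ring.
Qed.

(** The integral over a circle of radius tending to 0 tends to 2 pi f(0). *)
Lemma Cmod_center_le f r M : 0 < r < 1 ->
  (forall z, disk z -> cdiff f z) ->
  (forall z, Cmod z = r -> Cmod (f z) <= M) -> Cmod (f (RtoC 0)) <= M.
Proof.
  intros Hr Hf HM. apply le_epsilon. intros eps He.
  destruct (cdiff_ccont f _ (Hf _ disk_0) eps He) as [d [Hd Hcont]].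
  set (b := ln r). assert (Eb : exp b = r) by (apply exp_ln; lra).
  assert (Hb : b < 0) by (apply exp_lt_inv; rewrite Eb, exp_0; lra).
  set (r' := Rmin d r / 2).
  assert (Hr' : 0 < r' /\ r' < d /\ r' < r).
  { unfold r'. pose proof (Rmin_l d r). pose proof (Rmin_r d r).
    assert (0 < Rmin d r) by (apply Rmin_pos; lra). lra. }
  set (a := ln r'). assert (Ea : exp a = r') by (apply exp_ln; lra).
  assert (Hab : a < b) by (apply exp_lt_inv; rewrite Eb, Ea; lra).
  pose proof (circle_integral_const f a b Hab Hb Hf) as E.
  set (F := fun z => f (cexp z)) in E.
  assert (HF : forall s, s < 0 -> forall t, ccont F (s, t)).
  { intros s Hs t. apply cdiff_ccont. apply (cdiff_comp f cexp); [apply cdiff_cexp|].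
    apply Hf. unfold disk. rewrite Cmod_cexp. simpl.
    rewrite <- exp_0. now apply exp_increasing. }
  assert (HPI : 0 < 2 * PI) by (pose proof PI_RGT_0; lra).
  assert (HB : Cmod (vint F 0 (2 * PI) b) <= (2 * PI - 0) * M).
  { apply Cmod_CInt_le; [lra|apply ex_vint; [lra|auto]|].
    intros t _. apply HM. now rewrite Cmod_cexp. }
  assert (HA : Cmod (vint F 0 (2 * PI) a - RtoC (2 * PI) * f (RtoC 0)) <= (2 * PI - 0) * eps).
  { assert (Hint : ex_CInt (fun t => F (a, t)) 0 (2 * PI))
      by (apply ex_vint; [lra|intros; apply HF; lra]).
    assert (Hcst : ex_CInt (fun _ => f (RtoC 0)) 0 (2 * PI)) by apply ex_RInt_const.
    assert (Ec : CInt (fun t => F (a, t) - f (RtoC 0))%C 0 (2 * PI)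
              = (vint F 0 (2 * PI) a - RtoC (2 * PI) * f (RtoC 0))%C).
    { eapply eq_trans; [exact (RInt_minus (V := C_R_CompleteNormedModule) _ _ _ _ Hint Hcst)|].
      rewrite RInt_const, scal_R_Cmult. unfold vint. rewrite Rminus_0_r. reflexivity. }
    rewrite <- Ec. apply Cmod_CInt_le; [lra| |].
    - exact (ex_RInt_minus (V := C_R_CompleteNormedModule) _ _ _ _ Hint Hcst).
    - intros t _. left. apply Hcont.
      replace (cexp (a, t) - 0)%C with (cexp (a, t)) by ring.
      rewrite Cmod_cexp. simpl. lra. }
  rewrite E in HA.
  assert (Hsum : 2 * PI * Cmod (f (RtoC 0)) <= 2 * PI * (M + eps)).
  { replace (2 * PI * Cmod (f (RtoC 0))) with (Cmod (RtoC (2 * PI) * f (RtoC 0))).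
    - replace (RtoC (2 * PI) * f (RtoC 0))%C
        with (vint F 0 (2 * PI) b - (vint F 0 (2 * PI) b - RtoC (2 * PI) * f (RtoC 0)))%C
        by ring.
      eapply Rle_trans; [apply Cmod_triangle|]. rewrite Cmod_opp. lra.
    - rewrite Cmod_mult, Cmod_R, Rabs_pos_eq; lra. }
  apply Rmult_le_reg_l in Hsum; lra.
Qed.

(** The Moebius automorphism of the disk that sends [c] to 0; its inverse is
    [mob (- c)]. *)
Definition mob (c z : C) : C := ((z - c) / (1 - Cconj c * z))%C.

(** The identity that makes [mob c] preserve the disk and that turns [Cmod_mob_sqr]
    into a rate of approach to the unit circle. *)
Lemma Cmod_pick (c z : C) :
  Cmod (1 - Cconj c * z) ^ 2 - Cmod (z - c) ^ 2 = (1 - Cmod c ^ 2) * (1 - Cmod z ^ 2).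
Proof.
  rewrite !Cmod2_alt. destruct c as [a b], z as [x y]. unfold Cconj; simpl. ring.
Qed.

Lemma Cmod_1_sub_ge c z : disk z -> 1 - Cmod c <= Cmod (1 - Cconj c * z).
Proof.
  unfold disk. intros Hz. pose proof (Cmod_sub_ge 1 (Cconj c * z)) as H.
  rewrite Cmod_1, Cmod_mult, Cmod_conj in H.
  pose proof (Cmod_ge_0 c). pose proof (Cmod_ge_0 z). nra.
Qed.

Lemma mob_den c z : disk c -> disk z -> (1 - Cconj c * z)%C <> RtoC 0.
Proof.
  intros Hc Hz. apply Cmod_gt_0. pose proof (Cmod_1_sub_ge c z Hz).
  unfold disk in Hc. lra.
Qed.

Lemma Cmod_mob_sqr c z : disk c -> disk z ->
  1 - Cmod (mob c z) ^ 2 =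
    (1 - Cmod c ^ 2) * (1 - Cmod z ^ 2) / Cmod (1 - Cconj c * z) ^ 2.
Proof.
  intros Hc Hz. pose proof (mob_den c z Hc Hz) as Hn. unfold mob.
  rewrite Cmod_div by exact Hn. rewrite <- Cmod_pick.
  apply Cmod_gt_0 in Hn. field. lra.
Qed.

Lemma disk_sqr z : disk z <-> 0 < 1 - Cmod z ^ 2.
Proof. unfold disk. pose proof (Cmod_ge_0 z). split; intros; nra. Qed.

Lemma mob_disk c z : disk c -> disk z -> disk (mob c z).
Proof.
  intros Hc Hz. apply disk_sqr. rewrite Cmod_mob_sqr by assumption.
  pose proof (proj1 (Cmod_gt_0 _) (mob_den c z Hc Hz)) as Hn.
  apply Rdiv_lt_0_compat; [|now apply pow_lt].
  apply Rmult_lt_0_compat; now apply disk_sqr.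
Qed.

Lemma disk_opp c : disk c -> disk (- c)%C.
Proof. unfold disk. now rewrite Cmod_opp. Qed.

Lemma mobK c z : disk c -> disk z -> mob (- c) (mob c z) = z.
Proof.
  intros Hc Hz. pose proof (mob_den c z Hc Hz) as H1.
  pose proof (mob_den c c Hc Hc) as H2. unfold mob. rewrite Copp_conj.
  field. split; [exact H1|].
  intros E. apply H2. rewrite <- E. ring.
Qed.

Lemma mobK' c z : disk c -> disk z -> mob c (mob (- c) z) = z.
Proof.
  intros Hc Hz. pose proof (mobK (- c) z (disk_opp c Hc) Hz) as H.
  now replace (- - c)%C with c in H by ring.
Qed.

Lemma mob_0 c : mob c c = RtoC 0.
Proof. unfold mob, Cdiv. ring. Qed.

Lemma cdiff_mob c z : disk c -> disk z -> cdiff (mob c) z.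
Proof.
  intros Hc Hz.
  apply (cdiff_mult (fun y => (y - c)%C) (fun y => (/ (1 - Cconj c * y))%C)).
  - apply cdiff_minus; [apply cdiff_id|apply cdiff_const].
  - apply (cdiff_inv (fun y => (1 - Cconj c * y)%C)); [|now apply mob_den].
    apply cdiff_minus; [apply cdiff_const|].
    apply cdiff_mult; [apply cdiff_const|apply cdiff_id].
Qed.

(** The limit superior of |f| at the unit circle is at most [M]. *)
Definition bdry_le (f : C -> C) (M : R) : Prop :=
  forall eps, 0 < eps -> exists rho, rho < 1 /\
    forall z, rho < Cmod z -> disk z -> Cmod (f z) <= M + eps.

(** For any [a], compare the value at the centre of f o T_(-a) with its values
    on a circle of radius close to 1, whose image under T_(-a) is close to the
    unit circle. *)
Lemma maximum_principle f M : (forall z, disk z -> cdiff f z) -> bdry_le f M ->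
  forall a, disk a -> Cmod (f a) <= M.
Proof.
  intros Hf HM a Ha. apply le_epsilon. intros eps He.
  destruct (HM eps He) as [rho0 [Hrho0 Hb0]].
  set (rho := Rmax 0 rho0).
  assert (Hrho : 0 <= rho < 1) by (unfold rho; split; [apply Rmax_l|apply Rmax_lub_lt; lra]).
  assert (Hb : forall z, rho < Cmod z -> disk z -> Cmod (f z) <= M + eps).
  { intros z Hz. apply Hb0. apply Rle_lt_trans with (2 := Hz). apply Rmax_r. }
  pose proof Ha as Ha'. unfold disk in Ha'. pose proof (Cmod_ge_0 a) as Ha0.
  (* |z| = 1 - eta is mapped outside |w| <= rho, because
     1 - |w|^2 <= (1 - |z|^2) (1 + |a|) / (1 - |a|) *)
  set (eta := (1 - rho ^ 2) * (1 - Cmod a) / 8).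
  assert (Heta : 0 < eta <= 1 / 8).
  { assert (0 < 1 - rho ^ 2 <= 1) by nra. assert (0 < 1 - Cmod a <= 1) by lra.
    unfold eta. split; nra. }
  replace (f a) with (f (mob (- a) (RtoC 0))) by now rewrite <- (mob_0 a), mobK.
  apply (Cmod_center_le (fun z => f (mob (- a) z)) (1 - eta)); [lra| |].
  - intros z Hz. apply (cdiff_comp f (mob (- a))).
    + apply cdiff_mob; [now apply disk_opp|exact Hz].
    + apply Hf, mob_disk; [now apply disk_opp|exact Hz].
  - intros z Hz. assert (Hdz : disk z) by (unfold disk; lra).
    assert (Hda := disk_opp a Ha).
    apply Hb; [|now apply mob_disk].
    pose proof (Cmod_mob_sqr (- a) z Hda Hdz) as E.
    pose proof (Cmod_1_sub_ge (- a) z Hdz) as Hden.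
    rewrite Cmod_opp in *. rewrite Hz in E.
    set (D := Cmod (1 - Cconj (- a) * z)) in *.
    set (m := Cmod (mob (- a) z)) in *.
    assert (Hm : 0 <= m) by apply Cmod_ge_0.
    assert (Hlt : 1 - m ^ 2 < 1 - rho ^ 2).
    { rewrite E. apply Rmult_lt_reg_r with (D ^ 2); [nra|].
      replace ((1 - Cmod a ^ 2) * (1 - (1 - eta) ^ 2) / D ^ 2 * D ^ 2)
        with ((1 - Cmod a ^ 2) * (1 - (1 - eta) ^ 2)) by (field; nra).
      apply Rlt_le_trans with ((1 - rho ^ 2) * (1 - Cmod a) ^ 2).
      - replace ((1 - rho ^ 2) * (1 - Cmod a) ^ 2) with (8 * eta * (1 - Cmod a))
          by (unfold eta; field).
        replace ((1 - Cmod a ^ 2) * (1 - (1 - eta) ^ 2))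
          with ((1 + Cmod a) * (2 * eta - eta ^ 2) * (1 - Cmod a)) by ring.
        apply Rmult_lt_compat_r; nra.
      - apply Rmult_le_compat_l; nra. }
    nra.
Qed.

Lemma pow_le_imp_le (p X M A : R) : 0 < p -> 0 <= X -> 0 < M ->
  (forall n, p * X ^ n <= A * M ^ n) -> X <= M.
Proof.
  intros Hp HX HM H. destruct (Rle_or_lt X M) as [|Hlt]; [assumption|exfalso].
  assert (Hr : 1 < Rabs (X / M)).
  { rewrite Rabs_pos_eq by (left; apply Rdiv_lt_0_compat; lra).
    apply Rmult_lt_reg_r with M; [exact HM|]. unfold Rdiv.
    rewrite Rmult_assoc, Rinv_l; lra. }
  destruct (Pow_x_infinity (X / M) Hr (A / p + 1)) as [N HN].
  specialize (HN N (le_n N)). specialize (H N).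
  rewrite Rabs_pos_eq in HN
    by (apply pow_le; left; apply Rdiv_lt_0_compat; lra).
  assert (HMN : 0 < M ^ N) by now apply pow_lt.
  unfold Rdiv in HN at 1. rewrite Rpow_mult_distr, pow_inv in HN.
  apply Rge_le in HN. apply (Rmult_le_compat_r (p * M ^ N)) in HN; [|nra].
  replace (X ^ N * / M ^ N * (p * M ^ N)) with (p * X ^ N) in HN by (field; lra).
  replace ((A / p + 1) * (p * M ^ N)) with (A * M ^ N + p * M ^ N) in HN by (field; lra).
  nra.
Qed.

Lemma exists_avoiding_two (s p q : R) : 0 < s ->
  exists t, 0 < t < s /\ t <> p /\ t <> q.
Proof.
  intros Hs.
  destruct (Req_dec (s / 4) p), (Req_dec (s / 4) q), (Req_dec (s / 2) p),
    (Req_dec (s / 2) q);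
  first [exists (s / 4); lra | exists (s / 2); lra | exists (3 * s / 4); lra].
Qed.

Lemma ccont_le_closure f M e c z : disk z -> ccont f z ->
  (forall y, disk y -> y <> e -> y <> c -> Cmod (f y) <= M) -> Cmod (f z) <= M.
Proof.
  intros Hz Hf HM. apply le_epsilon. intros eps He.
  destruct (Hf eps He) as [d [Hd H]]. unfold disk in Hz.
  destruct (exists_avoiding_two (Rmin d (1 - Cmod z)) (fst e - fst z) (fst c - fst z))
    as [t [Ht [Hte Htc]]]; [apply Rmin_pos; lra|].
  pose proof (Rmin_l d (1 - Cmod z)). pose proof (Rmin_r d (1 - Cmod z)).
  set (y := (z + RtoC t)%C).
  assert (Hyz : Cmod (y - z) = t).
  { unfold y. replace (z + t - z)%C with (RtoC t) by ring.
    rewrite Cmod_R. apply Rabs_pos_eq. lra. }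
  assert (Hfy : fst y = fst z + t) by reflexivity.
  assert (Hy : Cmod (f y) <= M).
  { apply HM.
    - unfold disk. pose proof (Cmod_sub_ge y z). lra.
    - intros E. rewrite <- E in Hte. lra.
    - intros E. rewrite <- E in Htc. lra. }
  specialize (H y ltac:(lra)). rewrite Cmod_sub_sym in H.
  pose proof (Cmod_sub_ge (f z) (f y)). lra.
Qed.

(** (z - e) (z - c) f(z)^n is differentiable everywhere, so it obeys the maximum
    principle for all n; taking n-th roots makes the two linear factors
    disappear.  The point [e] may lie on the unit circle, where it is no
    exception at all. *)
Lemma maximum_principle_exc f M e c : 0 <= M -> Cmod e <= 1 -> disk c ->
  (forall z, disk z -> ccont f z) ->
  (forall z, disk z -> z <> e -> z <> c -> cdiff f z) -> bdry_le f M ->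
  forall a, disk a -> Cmod (f a) <= M.
Proof.
  intros HM He Hc Hcont Hdiff Hb.
  assert (Hoff : forall a, disk a -> a <> e -> a <> c -> Cmod (f a) <= M).
  { intros a Ha Hae Hac. apply le_epsilon. intros eps Heps.
    apply (pow_le_imp_le (Cmod (a - e) * Cmod (a - c)) _ _ 4).
    - apply Rmult_lt_0_compat; apply Cmod_gt_0, Cminus_eq_contra; assumption.
    - apply Cmod_ge_0.
    - lra.
    - intros n.
      rewrite <- Cmod_pow, <- !Cmod_mult.
      apply (maximum_principle (fun z => (z - e) * (z - c) * f z ^ n)%C); [| |exact Ha].
      + intros z Hz.
        assert (Hid : forall w, cdiff (fun y => (y - w)%C) z)
          by (intros w; apply cdiff_minus; [apply cdiff_id|apply cdiff_const]).
        destruct (Ceq_dec z e) as [->|Hze].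
        { apply cdiff_ext_loc with (fun y => (y - e) * ((y - c) * f y ^ n))%C 1;
            [lra|intros; ring|].
          apply cdiff_mul_vanish, ccont_mult; [apply cdiff_ccont, Hid|].
          now apply ccont_pow, Hcont. }
        destruct (Ceq_dec z c) as [->|Hzc].
        { apply cdiff_ext_loc with (fun y => (y - c) * ((y - e) * f y ^ n))%C 1;
            [lra|intros; ring|].
          apply cdiff_mul_vanish, ccont_mult; [apply cdiff_ccont, Hid|].
          now apply ccont_pow, Hcont. }
        apply cdiff_mult; [apply cdiff_mult; apply Hid|]. apply cdiff_pow. auto.
      + intros eps' Heps'. destruct (Hb eps Heps) as [rho [Hrho H]].
        exists rho. split; [exact Hrho|]. intros z Hz Hdz.
        specialize (H z Hz Hdz).
        rewrite !Cmod_mult, Cmod_pow.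
        assert (H2 : forall w, Cmod w <= 1 -> Cmod (z - w) <= 2).
        { intros w Hw. eapply Rle_trans; [apply Cmod_triangle|].
          rewrite Cmod_opp. unfold disk in Hdz. lra. }
        pose proof (H2 e He) as E1. pose proof (H2 c ltac:(unfold disk in Hc; lra)) as E2.
        assert (E3 : Cmod (f z) ^ n <= (M + eps) ^ n)
          by (apply pow_incr; split; [apply Cmod_ge_0|exact H]).
        assert (E4 : Cmod (z - e) * Cmod (z - c) <= 4).
        { pose proof (Cmod_ge_0 (z - e)). pose proof (Cmod_ge_0 (z - c)). nra. }
        apply Rle_trans with (4 * (M + eps) ^ n); [|lra].
        apply Rmult_le_compat; try assumption.
        * apply Rmult_le_pos; apply Cmod_ge_0.
        * apply pow_le, Cmod_ge_0. }
  intros a Ha. apply (ccont_le_closure f M e c); auto.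
Qed.

(** * The Schwarz-Pick inequality *)

Lemma quotient_eq f q c y :
  (f y - f c = q y * (y - c))%C -> y <> c -> q y = ((f y - f c) / (y - c))%C.
Proof.
  intros E Hy. rewrite E. field. now apply Cminus_eq_contra.
Qed.

Lemma ccont_quotient f q c z :
  (forall y, (f y - f c = q y * (y - c))%C) -> z <> c -> ccont f z -> ccont q z.
Proof.
  intros E Hz Hf.
  assert (Hd : 0 < Cmod (z - c)) by now apply Cmod_gt_0, Cminus_eq_contra.
  apply ccont_ext_loc with (fun y => (f y - f c) * / (y - c))%C (Cmod (z - c)); [exact Hd| |].
  - intros y Hy. symmetry. apply quotient_eq; [apply E|].
    intros ->. rewrite Cmod_sub_sym in Hy. lra.
  - apply ccont_mult; [apply ccont_minus; [exact Hf|apply ccont_const]|].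
    apply (ccont_inv (fun y => y - c)%C); [|now apply Cmod_gt_0].
    apply ccont_minus; [apply ccont_id|apply ccont_const].
Qed.

Lemma cdiff_quotient f q c z :
  (forall y, (f y - f c = q y * (y - c))%C) -> z <> c -> cdiff f z -> cdiff q z.
Proof.
  intros E Hz Hf.
  assert (Hd : 0 < Cmod (z - c)) by now apply Cmod_gt_0, Cminus_eq_contra.
  apply cdiff_ext_loc with (fun y => (f y - f c) * / (y - c))%C (Cmod (z - c)); [exact Hd| |].
  - intros y Hy. symmetry. apply quotient_eq; [apply E|].
    intros ->. rewrite Cmod_sub_sym in Hy. lra.
  - apply cdiff_mult; [apply cdiff_minus; [exact Hf|apply cdiff_const]|].
    apply (cdiff_inv (fun y => y - c)%C); [|now apply Cmod_gt_0].
    apply cdiff_minus; [apply cdiff_id|apply cdiff_const].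
Qed.

Lemma Cmod_sub_le_pick c z : Cmod c <= 1 -> Cmod z <= 1 ->
  Cmod (z - c) <= Cmod (1 - Cconj c * z).
Proof.
  intros Hc Hz. pose proof (Cmod_pick c z) as E.
  pose proof (Cmod_ge_0 c). pose proof (Cmod_ge_0 z).
  pose proof (Cmod_ge_0 (z - c)). pose proof (Cmod_ge_0 (1 - Cconj c * z)).
  assert (0 <= (1 - Cmod c ^ 2) * (1 - Cmod z ^ 2)) by (apply Rmult_le_pos; nra).
  nra.
Qed.

(** |T_c(z)| tends to 1 at the unit circle, which is why dividing by T_c costs
    nothing in the maximum principle. *)
Lemma pick_ratio_bdry c eps : disk c -> 0 < eps -> exists rho, rho < 1 /\
  forall z, rho < Cmod z -> disk z ->
    z <> c /\ Cmod (1 - Cconj c * z) <= (1 + eps) * Cmod (z - c).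
Proof.
  unfold disk. intros Hc He. pose proof (Cmod_ge_0 c) as Hc0.
  set (m := (1 - Cmod c) / 2). assert (Hm : 0 < m <= 1 / 2) by (unfold m; lra).
  set (eta := Rmin m (eps * m ^ 2)).
  assert (Heta : 0 < eta) by (apply Rmin_pos; [lra|]; apply Rmult_lt_0_compat; nra).
  assert (H1 : eta <= m) by apply Rmin_l. assert (H2 : eta <= eps * m ^ 2) by apply Rmin_r.
  exists (1 - eta). split; [lra|]. intros z Hz Hdz.
  assert (Hd : m <= Cmod (z - c)).
  { pose proof (Cmod_sub_ge z c). unfold m in *. lra. }
  split.
  { intros ->. rewrite Cmod_sub_diag in Hd. lra. }
  pose proof (Cmod_pick c z) as E. pose proof (Cmod_ge_0 (1 - Cconj c * z)).
  set (X := Cmod (1 - Cconj c * z)) in *. set (d := Cmod (z - c)) in *.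
  assert (Hz2 : 0 < 1 - Cmod z ^ 2 <= 2 * eta) by nra.
  assert (Hc2 : 0 < 1 - Cmod c ^ 2 <= 1) by nra.
  assert (HX : X ^ 2 <= d ^ 2 + 2 * eps * m ^ 2) by nra.
  assert (Hdm : m ^ 2 <= d ^ 2) by nra.
  assert (HX2 : X ^ 2 <= ((1 + eps) * d) ^ 2).
  { assert (0 <= eps ^ 2 * d ^ 2) by (apply Rmult_le_pos; apply pow2_ge_0).
    replace (((1 + eps) * d) ^ 2) with (d ^ 2 + 2 * eps * d ^ 2 + eps ^ 2 * d ^ 2) by ring.
    nra. }
  apply Rsqr_incr_0_var; [unfold Rsqr; nra|nra].
Qed.

(** The quotient T_(G(c))(G(z)) / T_c(z) is continuous on the disk,
    differentiable off [e] and [c], and has limit superior at most 1 at the unit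
    circle.  The inequality is stated without division, since in
    [schwarz_pick_exc] the denominators may vanish. *)
Lemma schwarz_pick_strict G e c :
  Cmod e <= 1 -> disk c -> c <> e ->
  (forall z, disk z -> ccont G z) -> (forall z, disk z -> z <> e -> cdiff G z) ->
  (forall z, disk z -> disk (G z)) ->
  forall z, disk z ->
    Cmod (G z - G c) * Cmod (1 - Cconj c * z) <=
    Cmod (1 - Cconj (G c) * G z) * Cmod (z - c).
Proof.
  intros He Hc Hce Hcont Hdiff HG z Hz.
  destruct (Hdiff c Hc Hce) as [q [Hq E]].
  assert (Hden : forall y, disk y -> (1 - Cconj (G c) * G y)%C <> RtoC 0)
    by (intros y Hy; apply mob_den; auto).
  set (H := fun y => (q y * (1 - Cconj c * y) * / (1 - Cconj (G c) * G y))%C).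
  assert (EH : forall y, disk y ->
    Cmod (H y) * Cmod (y - c) * Cmod (1 - Cconj (G c) * G y)
      = Cmod (G y - G c) * Cmod (1 - Cconj c * y)).
  { intros y Hy. rewrite E. rewrite <- !Cmod_mult. f_equal. unfold H. field.
    now apply Hden. }
  assert (Hmax : Cmod (H z) <= 1).
  { apply (maximum_principle_exc H 1 e c); auto; [lra| | |].
    - intros y Hy. unfold H. apply ccont_mult.
      + apply ccont_mult.
        * destruct (Ceq_dec y c) as [->|Hyc]; [exact Hq|].
          apply (ccont_quotient G q c); auto.
        * apply ccont_minus; [apply ccont_const|].
          apply ccont_mult; [apply ccont_const|apply ccont_id].
      + apply (ccont_inv (fun y => (1 - Cconj (G c) * G y)%C)); [|auto].
        apply ccont_minus; [apply ccont_const|].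
        apply ccont_mult; [apply ccont_const|auto].
    - intros y Hy Hye Hyc. unfold H. apply cdiff_mult.
      + apply cdiff_mult.
        * apply (cdiff_quotient G q c); auto.
        * apply cdiff_minus; [apply cdiff_const|].
          apply cdiff_mult; [apply cdiff_const|apply cdiff_id].
      + apply (cdiff_inv (fun y => (1 - Cconj (G c) * G y)%C)); [|auto].
        apply cdiff_minus; [apply cdiff_const|].
        apply cdiff_mult; [apply cdiff_const|auto].
    - intros eps Heps. destruct (pick_ratio_bdry c eps Hc Heps) as [rho [Hrho Hb]].
      exists rho. split; [exact Hrho|]. intros y Hy Hdy.
      destruct (Hb y Hy Hdy) as [Hyc Hratio]. specialize (EH y Hdy).
      assert (Hd : 0 < Cmod (y - c)) by now apply Cmod_gt_0, Cminus_eq_contra.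
      assert (HD : 0 < Cmod (1 - Cconj (G c) * G y)) by now apply Cmod_gt_0, Hden.
      assert (Hpick : Cmod (G y - G c) <= Cmod (1 - Cconj (G c) * G y))
        by (apply Cmod_sub_le_pick; left; now apply HG).
      pose proof (Cmod_ge_0 (1 - Cconj c * y)) as H0.
      apply Rmult_le_reg_r with (Cmod (y - c) * Cmod (1 - Cconj (G c) * G y));
        [now apply Rmult_lt_0_compat|].
      rewrite <- Rmult_assoc, EH.
      apply Rle_trans with (Cmod (1 - Cconj (G c) * G y) * Cmod (1 - Cconj c * y)).
      + apply Rmult_le_compat_r; assumption.
      + rewrite (Rmult_comm (Cmod (y - c))), <- Rmult_assoc, (Rmult_comm (1 + eps)),
          Rmult_assoc.
        apply Rmult_le_compat_l; lra. }
  rewrite <- EH by exact Hz. pose proof (Cmod_ge_0 (z - c)).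
  pose proof (Cmod_ge_0 (1 - Cconj (G c) * G z)).
  rewrite (Rmult_comm (Cmod (1 - _))), <- (Rmult_1_l (Cmod (z - c) * _)), Rmult_assoc.
  apply Rmult_le_compat_r; [now apply Rmult_le_pos|exact Hmax].
Qed.

Lemma Rle_of_scaled X A B : (forall t, 0 < t < 1 -> (1 - t) * X <= A + t * B) -> X <= A.
Proof.
  intros H. apply le_epsilon. intros eps He.
  set (K := Rabs X + Rabs B + 1).
  assert (HK : 0 < K) by (unfold K; pose proof (Rabs_pos X); pose proof (Rabs_pos B); lra).
  set (t := Rmin (1 / 2) (eps / K)).
  assert (Ht : 0 < t) by (apply Rmin_pos; [lra|now apply Rdiv_lt_0_compat]).
  assert (Ht1 : t <= 1 / 2) by apply Rmin_l.
  assert (Ht2 : t * K <= eps).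
  { apply Rle_trans with (eps / K * K); [|right; field; lra].
    apply Rmult_le_compat_r; [lra|apply Rmin_r]. }
  specialize (H t ltac:(lra)).
  assert (X <= Rabs X) by apply Rle_abs. assert (B <= Rabs B) by apply Rle_abs.
  assert (t * X <= t * Rabs X) by (apply Rmult_le_compat_l; lra).
  assert (t * B <= t * Rabs B) by (apply Rmult_le_compat_l; lra).
  unfold K in Ht2. lra.
Qed.

(** Apply the strict version to (1 - t) G and let t tend to 0.  Values of modulus
    1 have to be allowed: G is often a quotient F(w)/w, which is unimodular when
    F is a rotation. *)
Lemma schwarz_pick_exc G e c :
  Cmod e <= 1 -> disk c -> c <> e ->
  (forall z, disk z -> ccont G z) -> (forall z, disk z -> z <> e -> cdiff G z) ->
  (forall z, disk z -> Cmod (G z) <= 1) ->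
  forall z, disk z ->
    Cmod (G z - G c) * Cmod (1 - Cconj c * z) <=
    Cmod (1 - Cconj (G c) * G z) * Cmod (z - c).
Proof.
  intros He Hc Hce Hcont Hdiff HG z Hz.
  apply (Rle_of_scaled _ _ (2 * Cmod (z - c))). intros t Ht.
  pose proof (schwarz_pick_strict (fun y => RtoC (1 - t) * G y)%C e c He Hc Hce) as H.
  cbv beta in H.
  assert (Hl : Cmod (RtoC (1 - t)) = 1 - t) by (rewrite Cmod_R; apply Rabs_pos_eq; lra).
  specialize (H ltac:(intros; apply ccont_mult; [apply ccont_const|auto])
    ltac:(intros; apply cdiff_mult; [apply cdiff_const|auto])).
  assert (Hd : forall y, disk y -> disk (RtoC (1 - t) * G y)%C).
  { intros y Hy. unfold disk. rewrite Cmod_mult, Hl.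
    specialize (HG y Hy). pose proof (Cmod_ge_0 (G y)). nra. }
  specialize (H Hd z Hz).
  replace (RtoC (1 - t) * G z - RtoC (1 - t) * G c)%C
    with (RtoC (1 - t) * (G z - G c))%C in H by ring.
  rewrite Cmod_mult, Hl in H.
  apply Rle_trans with (Cmod (1 - Cconj (RtoC (1 - t) * G c) * (RtoC (1 - t) * G z))
    * Cmod (z - c)); [lra|].
  rewrite Rmult_comm, <- Rmult_assoc, <- Rmult_plus_distr_r.
  rewrite (Rmult_comm (Cmod (z - c))), (Rmult_comm t).
  apply Rmult_le_compat_r; [apply Cmod_ge_0|].
  replace (1 - Cconj (RtoC (1 - t) * G c) * (RtoC (1 - t) * G z))%C
    with ((1 - Cconj (G c) * G z) + RtoC (t * (2 - t)) * (Cconj (G c) * G z))%C.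
  - eapply Rle_trans; [apply Cmod_triangle|]. apply Rplus_le_compat_l.
    rewrite Cmod_mult, Cmod_R, Rabs_pos_eq, Cmod_mult, Cmod_conj by nra.
    pose proof (HG c Hc). pose proof (HG z Hz).
    pose proof (Cmod_ge_0 (G c)). pose proof (Cmod_ge_0 (G z)).
    assert (Cmod (G c) * Cmod (G z) <= 1) by nra.
    apply Rle_trans with (t * (2 - t) * 1); [|nra].
    apply Rmult_le_compat_l; nra.
  - rewrite Cmult_conj. destruct (G c) as [a b], (G z) as [x y].
    apply injective_projections; simpl; ring.
Qed.

Lemma schwarz_pick f c z :
  (forall y, disk y -> cdiff f y) -> (forall y, disk y -> Cmod (f y) <= 1) ->
  disk c -> disk z ->
  Cmod (f z - f c) * Cmod (1 - Cconj c * z) <=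
  Cmod (1 - Cconj (f c) * f z) * Cmod (z - c).
Proof.
  intros Hf Hb Hc Hz. apply (schwarz_pick_exc f 1 c); auto.
  - rewrite Cmod_1. lra.
  - intros ->. unfold disk in Hc. rewrite Cmod_1 in Hc. lra.
  - intros y Hy. now apply cdiff_ccont, Hf.
Qed.

Lemma schwarz f z :
  (forall y, disk y -> cdiff f y) -> (forall y, disk y -> Cmod (f y) <= 1) ->
  f (RtoC 0) = RtoC 0 -> disk z -> Cmod (f z) <= Cmod z.
Proof.
  intros Hf Hb H0 Hz. pose proof (schwarz_pick f 0 z Hf Hb disk_0 Hz) as H.
  rewrite H0 in H.
  replace (Cconj 0) with (RtoC 0) in H by (apply injective_projections; simpl; ring).
  replace (1 - 0 * z)%C with (RtoC 1) in H by ring.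
  replace (1 - 0 * f z)%C with (RtoC 1) in H by ring.
  replace (f z - 0)%C with (f z) in H by ring.
  replace (z - 0)%C with z in H by ring. rewrite Cmod_1 in H. lra.
Qed.

(** In the disk, F(z)/z inherits the bound 1 and is regular except that at 0 it
    is only known to be continuous. *)
Lemma schwarz_quotient F G :
  (forall y, disk y -> cdiff F y) -> (forall y, disk y -> Cmod (F y) <= 1) ->
  ccont G 0 -> (forall y, (F y = G y * y)%C) ->
  (forall z, disk z -> ccont G z) /\ (forall z, disk z -> z <> 0 -> cdiff G z) /\
  (forall z, disk z -> Cmod (G z) <= 1).
Proof.
  intros HF Hb HG E.
  assert (E0 : F (RtoC 0) = RtoC 0) by (rewrite E; ring).
  assert (E' : forall y, (F y - F (RtoC 0) = G y * (y - RtoC 0))%C)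
    by (intros y; rewrite E0, E; ring).
  assert (Hcont : forall z, disk z -> ccont G z).
  { intros z Hz. destruct (Ceq_dec z 0) as [->|Hz0]; [exact HG|].
    apply (ccont_quotient F G 0); auto. now apply cdiff_ccont, HF. }
  split; [exact Hcont|]. split.
  - intros z Hz Hz0. apply (cdiff_quotient F G 0); auto.
  - intros z Hz. apply (ccont_le_closure G 1 0 0); auto. intros y Hy Hy0 _.
    apply Rmult_le_reg_r with (Cmod y); [now apply Cmod_gt_0|].
    rewrite <- Cmod_mult, <- E, Rmult_1_l. now apply schwarz.
Qed.

(** Quantitative rigidity in the Schwarz lemma: a self-map that fixes 0 and nearly
    fixes [r] is nearly the identity.  G(w) = F(w)/w equals [q] at [r] and lies
    at pseudo-hyperbolic distance at most [d] from [q]; with x = |1 - G(w)| this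
    gives x - (1 - q) <= d ((1 - q) + q x). *)
Lemma schwarz_stability F r q w d :
  (forall y, disk y -> cdiff F y) -> (forall y, disk y -> Cmod (F y) <= 1) ->
  F (RtoC 0) = RtoC 0 -> 0 < r < 1 -> 0 <= q <= 1 -> F (RtoC r) = RtoC (q * r) ->
  disk w -> 0 <= d < 1 -> Cmod (w - r) <= d * Cmod (1 - r * w) ->
  Cmod (F w - w) <= (1 + d) / (1 - d) * (1 - q).
Proof.
  intros HF Hb H0 Hr Hq HFr Hw Hd Hrw.
  destruct (HF _ disk_0) as [G [HG0 E]]. rewrite H0 in E.
  assert (EG : forall y, (F y = G y * y)%C).
  { intros y. replace (F y) with (F y - 0)%C by ring. rewrite E. ring. }
  destruct (schwarz_quotient F G HF Hb HG0 EG) as (Hcont & Hdiff & HG).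
  assert (Hdr : disk (RtoC r)) by (unfold disk; rewrite Cmod_R, Rabs_pos_eq; lra).
  assert (Hr0 : RtoC r <> RtoC 0) by (intros e; apply RtoC_inj in e; lra).
  assert (HGr : G (RtoC r) = RtoC q).
  { rewrite EG, RtoC_mult in HFr.
    replace (G (RtoC r)) with (G (RtoC r) * RtoC r * / RtoC r)%C by (field; exact Hr0).
    rewrite HFr. field. exact Hr0. }
  pose proof (schwarz_pick_exc G 0 r ltac:(rewrite Cmod_0; lra) Hdr Hr0 Hcont Hdiff HG w Hw)
    as HP.
  rewrite HGr in HP.
  assert (Ecr : forall x : R, Cconj (RtoC x) = RtoC x)
    by (intros x; apply injective_projections; simpl; ring).
  rewrite !Ecr in HP.
  assert (HD : 0 < Cmod (1 - r * w)).
  { pose proof (Cmod_1_sub_ge r w Hw) as H. rewrite Ecr in H. unfold disk in Hdr. lra. }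
  assert (H1 : Cmod (G w - q) <= d * Cmod (1 - q * G w)).
  { apply Rmult_le_reg_r with (1 := HD). eapply Rle_trans; [exact HP|].
    rewrite (Rmult_comm d), Rmult_assoc. apply Rmult_le_compat_l; [apply Cmod_ge_0|exact Hrw]. }
  set (x := Cmod (1 - G w)) in *.
  assert (Hq1 : Cmod (RtoC (1 - q)) = 1 - q) by (rewrite Cmod_R; apply Rabs_pos_eq; lra).
  assert (H2 : x <= (1 - q) + Cmod (G w - q)).
  { unfold x. replace (1 - G w)%C with (RtoC (1 - q) + - (G w - q))%C
      by (rewrite RtoC_minus; ring).
    eapply Rle_trans; [apply Cmod_triangle|]. rewrite Cmod_opp, Hq1. lra. }
  assert (H3 : Cmod (1 - q * G w) <= (1 - q) + q * x).
  { replace (1 - q * G w)%C with (RtoC (1 - q) + q * (1 - G w))%C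
      by (rewrite RtoC_minus; ring).
    eapply Rle_trans; [apply Cmod_triangle|].
    rewrite Cmod_mult, Hq1, Cmod_R, (Rabs_pos_eq q) by lra. unfold x. lra. }
  assert (Hx0 : 0 <= x) by apply Cmod_ge_0.
  assert (H4 : x <= (1 + d) / (1 - d) * (1 - q)).
  { apply Rmult_le_reg_r with (1 - d); [lra|].
    replace ((1 + d) / (1 - d) * (1 - q) * (1 - d)) with ((1 + d) * (1 - q)) by (field; lra).
    assert (d * Cmod (1 - q * G w) <= d * ((1 - q) + q * x))
      by (apply Rmult_le_compat_l; lra).
    assert (d * (q * x) <= d * x) by (apply Rmult_le_compat_l; nra). nra. }
  apply Rle_trans with (2 := H4).
  replace (F w - w)%C with (- ((1 - G w) * w))%C by (rewrite EG; ring).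
  rewrite Cmod_opp, Cmod_mult. fold x. unfold disk in Hw. nra.
Qed.

(** Schwarz for [f] and [g] gives |f(z)| = |z|, so f(z)/z is unimodular.  For
    unimodular values the two sides of Schwarz-Pick carry the same factor
    |G(z) - G(c)|, which therefore vanishes. *)
Lemma rotation_of_automorphism f g :
  (forall y, disk y -> disk (f y) /\ cdiff f y) ->
  (forall y, disk y -> disk (g y) /\ cdiff g y) ->
  (forall y, disk y -> g (f y) = y) -> f (RtoC 0) = RtoC 0 ->
  exists l, Cmod l = 1 /\ forall z, disk z -> f z = (l * z)%C.
Proof.
  intros Hf Hg Hgf H0.
  assert (Hfd : forall y, disk y -> cdiff f y) by (intros; now apply Hf).
  assert (Hgd : forall y, disk y -> cdiff g y) by (intros; now apply Hg).
  assert (Hfb : forall y, disk y -> Cmod (f y) <= 1) by (intros; left; now apply Hf).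
  assert (Hgb : forall y, disk y -> Cmod (g y) <= 1) by (intros; left; now apply Hg).
  assert (Hg0 : g (RtoC 0) = RtoC 0) by (rewrite <- H0 at 1; apply Hgf, disk_0).
  assert (Hmod : forall z, disk z -> Cmod (f z) = Cmod z).
  { intros z Hz. apply Rle_antisym; [now apply schwarz|].
    rewrite <- (Hgf z Hz) at 1. apply schwarz; auto. now apply Hf. }
  destruct (Hfd _ disk_0) as [G [HG0 E]]. rewrite H0 in E.
  assert (EG : forall y, (f y = G y * y)%C).
  { intros y. replace (f y) with (f y - 0)%C by ring. rewrite E. ring. }
  destruct (schwarz_quotient f G Hfd Hfb HG0 EG) as (Hcont & Hdiff & HG).
  assert (HG1 : forall z, disk z -> z <> 0 -> Cmod (G z) = 1).
  { intros z Hz Hz0. apply Rmult_eq_reg_r with (Cmod z).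
    - rewrite <- Cmod_mult, <- EG, Hmod by exact Hz. ring.
    - apply Rgt_not_eq. now apply Cmod_gt_0. }
  set (c := RtoC (1 / 2)).
  assert (Hc0 : c <> RtoC 0) by (intros e; apply RtoC_inj in e; lra).
  assert (Hc : disk c) by (unfold disk, c; rewrite Cmod_R, Rabs_pos_eq; lra).
  exists (G c). split; [now apply HG1|]. intros z Hz.
  destruct (Ceq_dec z 0) as [->|Hz0]; [rewrite H0; ring|].
  rewrite EG. f_equal.
  pose proof (schwarz_pick_exc G 0 c ltac:(rewrite Cmod_0; lra) Hc Hc0 Hcont Hdiff HG z Hz)
    as HP.
  pose proof (Cmod_pick (G c) (G z)) as P1. rewrite (HG1 c Hc Hc0) in P1.
  pose proof (Cmod_pick c z) as P2.
  apply disk_sqr in Hc. apply disk_sqr in Hz.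
  pose proof (Rmult_lt_0_compat _ _ Hc Hz) as Hpos.
  apply Ceq_minus, Cmod_eq_0.
  pose proof (Cmod_ge_0 (G z - G c)). pose proof (Cmod_ge_0 (z - c)).
  pose proof (Cmod_ge_0 (1 - Cconj c * z)). pose proof (Cmod_ge_0 (1 - Cconj (G c) * G z)).
  set (X := Cmod (G z - G c)) in *. set (d := Cmod (z - c)) in *.
  set (D := Cmod (1 - Cconj c * z)) in *. set (Y := Cmod (1 - Cconj (G c) * G z)) in *.
  assert (HXY : Y = X) by nra. assert (HdD : d < D) by nra. nra.
Qed.

Lemma lipschitz_of_bound f B e c z : 0 < B ->
  Cmod e <= 1 -> disk c -> c <> e ->
  (forall y, disk y -> ccont f y) -> (forall y, disk y -> y <> e -> cdiff f y) ->
  (forall y, disk y -> Cmod (f y) <= B) -> disk z ->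
  Cmod (f z - f c) * (1 - Cmod c) <= 2 * B * Cmod (z - c).
Proof.
  intros HB He Hc Hce Hcont Hdiff Hf Hz.
  set (G := fun y => (RtoC (/ B) * f y)%C).
  assert (HiB : 0 < / B) by now apply Rinv_0_lt_compat.
  assert (HmB : Cmod (RtoC (/ B)) = / B) by (rewrite Cmod_R; apply Rabs_pos_eq; lra).
  assert (HG : forall y, disk y -> Cmod (G y) <= 1).
  { intros y Hy. unfold G. rewrite Cmod_mult, HmB.
    apply Rmult_le_reg_l with B; [exact HB|]. rewrite <- Rmult_assoc, Rinv_r by lra.
    rewrite Rmult_1_l, Rmult_1_r. auto. }
  assert (HP : Cmod (G z - G c) * Cmod (1 - Cconj c * z) <=
     Cmod (1 - Cconj (G c) * G z) * Cmod (z - c)).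
  { apply (schwarz_pick_exc G e c); auto; unfold G.
    - intros y Hy. apply ccont_mult; [apply ccont_const|auto].
    - intros y Hy Hye. apply cdiff_mult; [apply cdiff_const|auto]. }
  assert (E : Cmod (f z - f c) = B * Cmod (G z - G c)).
  { replace (G z - G c)%C with (RtoC (/ B) * (f z - f c))%C by (unfold G; ring).
    rewrite Cmod_mult, HmB. field. lra. }
  assert (H2 : Cmod (1 - Cconj (G c) * G z) <= 2).
  { unfold Cminus. eapply Rle_trans; [apply Cmod_triangle|].
    rewrite Cmod_opp, Cmod_1, Cmod_mult, Cmod_conj.
    pose proof (HG c Hc). pose proof (HG z Hz).
    pose proof (Cmod_ge_0 (G c)). pose proof (Cmod_ge_0 (G z)). nra. }
  pose proof (Cmod_1_sub_ge c z Hz) as H3.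
  pose proof (Cmod_ge_0 (G z - G c)). pose proof (Cmod_ge_0 (z - c)).
  assert (H4 : Cmod (G z - G c) * (1 - Cmod c) <= 2 * Cmod (z - c)).
  { apply Rle_trans with (Cmod (G z - G c) * Cmod (1 - Cconj c * z)).
    - apply Rmult_le_compat_l; assumption.
    - eapply Rle_trans; [exact HP|]. apply Rmult_le_compat_r; assumption. }
  rewrite E, !Rmult_assoc, (Rmult_comm 2), Rmult_assoc.
  apply Rmult_le_compat_l; lra.
Qed.

Lemma self_map_lipschitz f c z :
  (forall y, disk y -> cdiff f y) -> (forall y, disk y -> Cmod (f y) <= 1) ->
  disk c -> disk z -> Cmod (f z - f c) * (1 - Cmod c) <= 2 * Cmod (z - c).
Proof.
  intros Hf Hb Hc Hz. rewrite <- (Rmult_1_r 2).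
  apply (lipschitz_of_bound f 1 1); auto; [lra|rewrite Cmod_1; lra| |].
  - intros ->. unfold disk in Hc. rewrite Cmod_1 in Hc. lra.
  - intros y Hy. now apply cdiff_ccont, Hf.
Qed.

(** * Convergence of sequences of complex numbers *)

Definition cv (u : nat -> C) (l : C) : Prop :=
  forall eps, 0 < eps -> exists N : nat, forall n, (N <= n)%nat -> Cmod (u n - l) < eps.

Lemma cv_filterlim u l :
  cv u l <-> filterlim u eventually (@locally (AbsRing_UniformSpace C_AbsRing) l).
Proof.
  split.
  - intros H. apply (filterlim_locally (U := AbsRing_UniformSpace C_AbsRing)).
    intros eps. destruct (H eps (cond_pos eps)) as [N HN]. exists N. exact HN.
  - intros H eps He.
    exact (proj1 (filterlim_locally (U := AbsRing_UniformSpace C_AbsRing) u l) H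
      (mkposreal eps He)).
Qed.

Lemma cv_const a : cv (fun _ => a) a.
Proof. intros eps He. exists O. intros. now rewrite Cmod_sub_diag. Qed.

Lemma cv_plus u v a b : cv u a -> cv v b -> cv (fun n => (u n + v n)%C) (a + b)%C.
Proof.
  rewrite !cv_filterlim. intros Hu Hv.
  exact (filterlim_comp_2 _ _ _ Hu Hv
    (filterlim_plus (V := AbsRing_NormedModule C_AbsRing) a b)).
Qed.

Lemma cv_mult u v a b : cv u a -> cv v b -> cv (fun n => (u n * v n)%C) (a * b)%C.
Proof.
  rewrite !cv_filterlim. intros Hu Hv.
  exact (filterlim_comp_2 _ _ _ Hu Hv (filterlim_mult (K := C_AbsRing) a b)).
Qed.

Lemma cv_ccont f u l : ccont f l -> cv u l -> cv (fun n => f (u n)) (f l).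
Proof.
  intros Hf Hu eps He. destruct (Hf eps He) as [d [Hd H]].
  destruct (Hu d Hd) as [N HN]. exists N. auto.
Qed.

Lemma cv_ext u v l : (forall n, u n = v n) -> cv u l -> cv v l.
Proof.
  intros E H eps He. destruct (H eps He) as [N HN]. exists N.
  intros n Hn. rewrite <- E. auto.
Qed.

Lemma cv_minus u v a b : cv u a -> cv v b -> cv (fun n => (u n - v n)%C) (a - b)%C.
Proof.
  intros Hu Hv. unfold Cminus. apply cv_plus; [exact Hu|].
  apply (cv_ccont (fun y => (- y)%C) v b); [|exact Hv].
  apply ccont_ext_loc with (fun y => (0 - y)%C) 1; [lra|intros; ring|].
  apply ccont_minus; [apply ccont_const|apply ccont_id].
Qed.

Lemma cv_conj u l : cv u l -> cv (fun n => Cconj (u n)) (Cconj l).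
Proof.
  intros H eps He. destruct (H eps He) as [N HN]. exists N. intros n Hn.
  rewrite <- Cminus_conj, Cmod_conj. auto.
Qed.

Lemma cv_inv u l : l <> RtoC 0 -> cv u l -> cv (fun n => (/ u n)%C) (/ l)%C.
Proof.
  intros Hl Hu. apply (cv_ccont (fun y => (/ y)%C) u l); [|exact Hu].
  apply (ccont_inv (fun y => y)); [apply ccont_id|exact Hl].
Qed.

Lemma cv_dist_le u l a M : cv u l ->
  (exists N : nat, forall n, (N <= n)%nat -> Cmod (u n - a) <= M) -> Cmod (l - a) <= M.
Proof.
  intros Hu [N HN]. apply le_epsilon. intros eps He.
  destruct (Hu eps He) as [N' HN'].
  specialize (HN (N + N')%nat ltac:(lia)). specialize (HN' (N + N')%nat ltac:(lia)).
  replace (l - a)%C with ((u (N + N')%nat - a) - (u (N + N')%nat - l))%C by ring.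
  eapply Rle_trans; [apply Cmod_triangle|]. rewrite Cmod_opp. lra.
Qed.

Lemma cv_Cmod_le u l M : cv u l -> (forall n, Cmod (u n) <= M) -> Cmod l <= M.
Proof.
  intros Hu HM. replace l with (l - 0)%C by ring. apply (cv_dist_le u); [exact Hu|].
  exists O. intros n _. replace (u n - 0)%C with (u n) by ring. auto.
Qed.

Lemma cv_unique u a b : cv u a -> cv u b -> a = b.
Proof.
  intros Ha Hb. apply Ceq_minus, Cmod_eq_0.
  apply Rle_antisym; [|apply Cmod_ge_0]. apply le_epsilon. intros eps He.
  rewrite Rplus_0_l. apply (cv_dist_le u); [exact Ha|].
  destruct (Hb eps He) as [N HN]. exists N. intros n Hn. left. auto.
Qed.

Lemma cv_Cmod_eq u v a b : cv u a -> cv v b -> (forall n, Cmod (u n) = Cmod (v n)) ->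
  Cmod a = Cmod b.
Proof.
  assert (Hle : forall u v a b, cv u a -> cv v b -> (forall n, Cmod (u n) = Cmod (v n)) ->
    Cmod a <= Cmod b).
  { clear. intros u v a b Hu Hv E. apply le_epsilon. intros eps He.
    destruct (Hv eps He) as [N HN].
    replace a with (a - 0)%C by ring. apply (cv_dist_le u); [exact Hu|].
    exists N. intros n Hn. replace (u n - 0)%C with (u n) by ring. rewrite E.
    specialize (HN n Hn). pose proof (Cmod_sub_ge (v n) b). lra. }
  intros Hu Hv E. apply Rle_antisym; [now apply (Hle u v)|].
  apply (Hle v u); auto.
Qed.

Lemma cauchy_cv (u : nat -> C) :
  (forall eps, 0 < eps -> exists N : nat, forall n m, (N <= n)%nat -> (N <= m)%nat ->
     Cmod (u n - u m) < eps) ->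
  exists l, cv u l.
Proof.
  intros H.
  assert (Hre : ex_finite_lim_seq (fun n => fst (u n))).
  { apply ex_lim_seq_cauchy_corr. intros eps. destruct (H eps (cond_pos eps)) as [N HN].
    exists N. intros n m Hn Hm. eapply Rle_lt_trans; [|exact (HN n m Hn Hm)].
    eapply Rle_trans; [|apply Rmax_Cmod]. apply Rmax_l. }
  assert (Him : ex_finite_lim_seq (fun n => snd (u n))).
  { apply ex_lim_seq_cauchy_corr. intros eps. destruct (H eps (cond_pos eps)) as [N HN].
    exists N. intros n m Hn Hm. eapply Rle_lt_trans; [|exact (HN n m Hn Hm)].
    eapply Rle_trans; [|apply Rmax_Cmod]. apply Rmax_r. }
  destruct Hre as [x Hx], Him as [y Hy]. exists (x, y). intros eps He.
  apply is_lim_seq_spec in Hx. apply is_lim_seq_spec in Hy.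
  assert (He2 : 0 < eps / 2) by lra.
  destruct (Hx (mkposreal _ He2)) as [N1 H1]. destruct (Hy (mkposreal _ He2)) as [N2 H2].
  exists (N1 + N2)%nat. intros n Hn.
  specialize (H1 n ltac:(lia)). specialize (H2 n ltac:(lia)). simpl in H1, H2.
  eapply Rle_lt_trans; [apply (Cmod_le_sum (fst (u n) - x) (snd (u n) - y))|]. lra.
Qed.

Lemma telescoping_cv (u : nat -> C) (r : nat -> R) A :
  (forall n, Cmod (u (S n) - u n) <= A * (r n - r (S n))) ->
  (forall n, r (S n) <= r n) -> (forall n, 0 <= r n) -> 0 < A -> exists l, cv u l.
Proof.
  intros Hu Hr H0 HA.
  assert (Hlim : ex_finite_lim_seq r) by now apply ex_finite_lim_seq_decr with 0.
  apply ex_lim_seq_cauchy_corr in Hlim.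
  assert (Hsum : forall n k, Cmod (u (n + k)%nat - u n) <= A * (r n - r (n + k)%nat)).
  { intros n k. induction k as [|k IH].
    - rewrite Nat.add_0_r, Cmod_sub_diag. lra.
    - rewrite Nat.add_succ_r. specialize (Hu (n + k)%nat).
      replace (u (S (n + k)) - u n)%C
        with ((u (S (n + k)) - u (n + k)%nat) + (u (n + k)%nat - u n))%C by ring.
      eapply Rle_trans; [apply Cmod_triangle|]. lra. }
  apply cauchy_cv. intros eps He.
  assert (HeA : 0 < eps / A) by now apply Rdiv_lt_0_compat.
  destruct (Hlim (mkposreal _ HeA)) as [N HN]. simpl in HN.
  assert (Hle : forall n m, (N <= n)%nat -> (n <= m)%nat -> Cmod (u m - u n) < eps).
  { intros n m Hn Hm. replace m with (n + (m - n))%nat by lia.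
    eapply Rle_lt_trans; [apply Hsum|].
    specialize (HN n (n + (m - n))%nat Hn ltac:(lia)).
    apply Rle_lt_trans with (A * Rabs (r n - r (n + (m - n))%nat)).
    - apply Rmult_le_compat_l; [lra|apply Rle_abs].
    - replace eps with (A * (eps / A)) by (field; lra). now apply Rmult_lt_compat_l. }
  exists N. intros n m Hn Hm. destruct (Nat.le_ge_cases n m).
  - rewrite Cmod_sub_sym. now apply Hle.
  - now apply Hle.
Qed.

(** * Pointwise limits of holomorphic self-maps *)

(** Near the unit circle the numerator is at most 2 and |y - w| at least
    (1 - |w|) / 2; the maximum principle carries this bound inside, across the
    exceptional point [w]. *)
Lemma difference_quotient_bound f q w :
  (forall y, disk y -> cdiff f y) -> (forall y, disk y -> Cmod (f y) <= 1) ->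
  disk w -> ccont q w -> (forall y, (f y - f w = q y * (y - w))%C) ->
  (forall y, disk y -> ccont q y) /\ (forall y, disk y -> y <> w -> cdiff q y) /\
  (forall y, disk y -> Cmod (q y) <= 4 / (1 - Cmod w)).
Proof.
  intros Hf Hb Hw Hq E.
  assert (Hcont : forall y, disk y -> ccont q y).
  { intros y Hy. destruct (Ceq_dec y w) as [->|Hyw]; [exact Hq|].
    apply (ccont_quotient f q w); auto. now apply cdiff_ccont, Hf. }
  assert (Hdiff : forall y, disk y -> y <> w -> cdiff q y).
  { intros y Hy Hyw. apply (cdiff_quotient f q w); auto. }
  split; [exact Hcont|]. split; [exact Hdiff|].
  pose proof Hw as Hw1. unfold disk in Hw1.
  apply (maximum_principle_exc q _ w w); auto; [|lra|].
  - left. apply Rdiv_lt_0_compat; lra.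
  - intros eps He. exists ((1 + Cmod w) / 2). split; [lra|]. intros y Hy Hdy.
    apply Rle_trans with (4 / (1 - Cmod w)); [|lra].
    apply Rmult_le_reg_r with ((1 - Cmod w) / 2); [lra|].
    replace (4 / (1 - Cmod w) * ((1 - Cmod w) / 2)) with 2 by (field; lra).
    apply Rle_trans with (Cmod (q y) * Cmod (y - w)).
    + apply Rmult_le_compat_l; [apply Cmod_ge_0|]. pose proof (Cmod_sub_ge y w). lra.
    + rewrite <- Cmod_mult, <- E. eapply Rle_trans; [apply Cmod_triangle|].
      rewrite Cmod_opp. pose proof (Hb y Hdy). pose proof (Hb w Hw). lra.
Qed.

(** Equicontinuity of difference quotients replaces Cauchy's formula.  The
    quotients [q n] of [g n] at [w] are bounded by the same constant, hence
    Lipschitz near [w] with the same constant; so [q n w] converges, and its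
    limit is the derivative of [h] at [w]. *)
Lemma cdiff_limit (g : nat -> C -> C) (h : C -> C) :
  (forall n y, disk y -> cdiff (g n) y) -> (forall n y, disk y -> Cmod (g n y) <= 1) ->
  (forall y, disk y -> cv (fun n => g n y) (h y)) ->
  forall w, disk w -> cdiff h w.
Proof.
  intros Hg Hb Hcv w Hw.
  destruct (functional_choice (fun n q => ccont q w /\ forall y, (g n y - g n w = q y * (y - w))%C))
    as [q Hq]; [intros n; exact (Hg n w Hw)|].
  pose proof Hw as Hw1. unfold disk in Hw1. pose proof (Cmod_ge_0 w) as Hw0.
  set (B := 4 / (1 - Cmod w)).
  assert (HB : 0 < B) by (apply Rdiv_lt_0_compat; lra).
  set (s := (1 - Cmod w) / 2).
  assert (Hs : 0 < s) by (unfold s; lra).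
  set (L := 2 * B / s). assert (HL : 0 < L) by (apply Rdiv_lt_0_compat; lra).
  assert (Hnear : forall y, Cmod (y - w) < s -> disk y /\ s <= 1 - Cmod y).
  { intros y Hy. pose proof (Cmod_sub_ge y w). unfold disk, s in *. lra. }
  assert (Hlip : forall n y, Cmod (y - w) < s -> y <> w ->
     Cmod (q n y - q n w) <= L * Cmod (y - w)).
  { intros n y Hy Hyw. destruct (Hq n) as [Hqn En].
    destruct (difference_quotient_bound (g n) (q n) w (Hg n) (Hb n) Hw Hqn En)
      as (Hcont & Hdiff & Hbd).
    destruct (Hnear y Hy) as [Hdy Hsy].
    (* the Schwarz-Pick centre is y, as q n need not be differentiable at w *)
    assert (HP : Cmod (q n w - q n y) * (1 - Cmod y) <= 2 * B * Cmod (w - y)).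
    { apply (lipschitz_of_bound (q n) B w); auto. lra. }
    rewrite Cmod_sub_sym, (Cmod_sub_sym y w).
    apply Rmult_le_reg_r with s; [exact Hs|].
    replace (L * Cmod (w - y) * s) with (2 * B * Cmod (w - y)) by (unfold L; field; lra).
    eapply Rle_trans; [|exact HP]. apply Rmult_le_compat_l; [apply Cmod_ge_0|exact Hsy]. }
  assert (Hqcv : forall y, disk y -> y <> w ->
     cv (fun n => q n y) ((h y - h w) / (y - w))%C).
  { intros y Hy Hyw. apply cv_ext with (fun n => ((g n y - g n w) * / (y - w))%C).
    - intros n. symmetry. apply quotient_eq; [apply (Hq n)|exact Hyw].
    - apply cv_mult; [apply cv_minus; auto|apply cv_const]. }
  assert (Hl : exists l, cv (fun n => q n w) l).
  { apply cauchy_cv. intros eps He.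
    set (t := Rmin (s / 2) (eps / (4 * L))).
    assert (Ht : 0 < t) by (apply Rmin_pos; [lra|apply Rdiv_lt_0_compat; lra]).
    assert (Hts : t < s) by (assert (t <= s / 2) by apply Rmin_l; lra).
    assert (HtL : L * t <= eps / 4).
    { replace (eps / 4) with (L * (eps / (4 * L))) by (field; lra).
      apply Rmult_le_compat_l; [lra|apply Rmin_r]. }
    set (y := (w + RtoC t)%C).
    assert (Hyw : Cmod (y - w) = t).
    { unfold y. replace (w + t - w)%C with (RtoC t) by ring.
      rewrite Cmod_R. apply Rabs_pos_eq. lra. }
    assert (Hne : y <> w) by (intros e; rewrite e, Cmod_sub_diag in Hyw; lra).
    assert (Hys : Cmod (y - w) < s) by lra.
    destruct (Hqcv y (proj1 (Hnear y Hys)) Hne (eps / 4)) as [N HN]; [lra|].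
    exists N. intros n m Hn Hm.
    pose proof (Hlip n y Hys Hne) as A1. pose proof (Hlip m y Hys Hne) as A2.
    rewrite Hyw in A1, A2. pose proof (HN n Hn) as A3. pose proof (HN m Hm) as A4.
    set (l := ((h y - h w) / (y - w))%C) in *.
    replace (q n w - q m w)%C
      with (- (q n y - q n w) + (q n y - l) + - (q m y - l) + (q m y - q m w))%C by ring.
    eapply Rle_lt_trans; [apply Cmod_triangle|].
    eapply Rle_lt_trans; [apply Rplus_le_compat_r, Cmod_triangle|].
    eapply Rle_lt_trans; [apply Rplus_le_compat_r, Rplus_le_compat_r, Cmod_triangle|].
    rewrite !Cmod_opp. lra. }
  destruct Hl as [l Hl].
  apply cdiff_approx. exists l. intros eps He.
  exists (Rmin s (eps / L)). split; [apply Rmin_pos; [lra|now apply Rdiv_lt_0_compat]|].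
  intros y Hy.
  assert (Hys : Cmod (y - w) < s) by (eapply Rlt_le_trans; [exact Hy|apply Rmin_l]).
  assert (HyL : L * Cmod (y - w) <= eps).
  { replace eps with (L * (eps / L)) by (field; lra).
    apply Rmult_le_compat_l; [lra|]. left. eapply Rlt_le_trans; [exact Hy|apply Rmin_r]. }
  destruct (Ceq_dec y w) as [->|Hyw].
  { replace (h w - h w - l * (w - w))%C with (RtoC 0) by ring.
    rewrite Cmod_0, Cmod_sub_diag. lra. }
  destruct (Hnear y Hys) as [Hdy _].
  assert (Hlim : Cmod (((h y - h w) / (y - w) - l) - 0) <= L * Cmod (y - w)).
  { apply (cv_dist_le (fun n => (q n y - q n w)%C)).
    - apply cv_minus; auto.
    - exists O. intros n _. replace (q n y - q n w - 0)%C with (q n y - q n w)%C by ring.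
      auto. }
  assert (Hn : (y - w)%C <> RtoC 0) by now apply Cminus_eq_contra.
  replace (h y - h w - l * (y - w))%C
    with ((((h y - h w) / (y - w) - l) - 0) * (y - w))%C by (field; exact Hn).
  rewrite Cmod_mult. apply Rmult_le_compat_r; [apply Cmod_ge_0|lra].
Qed.

Lemma open_Cmod_ball (x : C) (r : R) :
  open (T := C_UniformSpace) (fun y : C => Cmod (y - x) < r).
Proof.
  intros y Hy. apply locally_C.
  assert (Hp : 0 < r - Cmod (y - x)) by lra.
  exists (mkposreal _ Hp). intros z Hz.
  change (Cmod (z - y) < r - Cmod (y - x)) in Hz.
  replace (z - x)%C with ((z - y) + (y - x))%C by ring.
  eapply Rle_lt_trans; [apply Cmod_triangle|]. lra.
Qed.

(** Self-maps are equicontinuous, so an estimate at one point holds from the same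
    rank on in a ball around it; finitely many such balls cover [K]. *)
Lemma cvg_unif_compacts_of_pointwise (g : nat -> C -> C) (h : C -> C) :
  (forall n y, disk y -> cdiff (g n) y) -> (forall n y, disk y -> Cmod (g n y) <= 1) ->
  (forall y, disk y -> cv (fun n => g n y) (h y)) -> cvg_unif_compacts_disk g h.
Proof.
  intros Hg Hb Hcv K HK HKd eps He.
  (* the open sets on which the estimate holds from some rank on *)
  set (Fam := fun U : C -> Prop => open (T := C_UniformSpace) U /\
    exists N : nat, forall n, (N <= n)%nat -> forall y, U y -> disk y ->
      Cmod (g n y - h y) < eps).
  destruct (HK Fam) as [l [Hl Hcov]].
  - intros U [HU _]. exact HU.
  - intros x Hx. assert (Hdx := HKd x Hx). pose proof Hdx as Hx1. unfold disk in Hx1.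
    pose proof (Cmod_ge_0 x).
    (* self-maps are 2 / (1 - |x|)-Lipschitz at x, so they vary by at most
       eps / 4 on this ball *)
    set (d := (1 - Cmod x) * (eps / 8)).
    assert (Hd : 0 < d) by (apply Rmult_lt_0_compat; lra).
    exists (fun y : C => Cmod (y - x) < d). split; [|now rewrite Cmod_sub_diag].
    split; [apply open_Cmod_ball|].
    destruct (Hcv x Hdx (eps / 4)) as [N HN]; [lra|].
    exists N. intros n Hn y Hy Hdy. specialize (HN n Hn).
    assert (Hlip : forall m, Cmod (g m y - g m x) <= eps / 4).
    { intros m. pose proof (self_map_lipschitz (g m) x y (Hg m) (Hb m) Hdx Hdy) as H1.
      apply Rmult_le_reg_r with (1 - Cmod x); [lra|]. unfold d in Hy. lra. }
    assert (Hh : Cmod ((h y - h x) - 0) <= eps / 4).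
    { apply (cv_dist_le (fun m => (g m y - g m x)%C)); [apply cv_minus; auto|].
      exists O. intros m _. replace (g m y - g m x - 0)%C with (g m y - g m x)%C by ring.
      auto. }
    replace (g n y - h y)%C
      with ((g n y - g n x) + (g n x - h x) + - ((h y - h x) - 0))%C by ring.
    eapply Rle_lt_trans; [apply Cmod_triangle|].
    eapply Rle_lt_trans; [apply Rplus_le_compat_r, Cmod_triangle|].
    rewrite Cmod_opp. specialize (Hlip n). lra.
  - assert (HN : exists N : nat, forall U, In U l -> forall n, (N <= n)%nat ->
      forall y, U y -> disk y -> Cmod (g n y - h y) < eps).
    { clear Hcov. induction l as [|U l IH].
      - exists O. intros U [].
      - destruct IH as [N HN]; [intros V HV; apply Hl; now right|].
        destruct (Hl U (or_introl eq_refl)) as [_ [N' HN']].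
        exists (N + N')%nat. intros V [<-|HV] n Hn.
        + apply HN'. lia.
        + apply (HN V HV). lia. }
    destruct HN as [N HN]. exists N. intros n Hn z Hz.
    destruct (Hcov z Hz) as [U [HU HUz]]. exact (HN U HU n Hn z HUz (HKd z Hz)).
Qed.

Lemma cv_of_cvg_unif_compacts g h z : cvg_unif_compacts_disk g h -> disk z ->
  cv (fun n => g n z) (h z).
Proof.
  intros H Hz eps He. destruct (H (fun y => y = z)) with (eps := eps) as [N HN]; auto.
  - intros Fam _ Hcov. destruct (Hcov z eq_refl) as [U [HU HUz]].
    exists (U :: nil). split.
    + intros V [<-|[]]. exact HU.
    + intros x ->. exists U. split; [now left|exact HUz].
  - now intros y ->.
  - exists N. intros n Hn. now apply HN.
Qed.

(** * Automorphisms of the disk *)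

Lemma holo_self_map_cdiff f :
  holo_self_map f <-> forall y, disk y -> disk (f y) /\ cdiff f y.
Proof.
  split.
  - intros [H1 H2] y Hy. split; [auto|]. now apply cdiff_ex_derive, H2.
  - intros H. split; [intros y Hy; now apply H|].
    intros y Hy. apply cdiff_ex_derive. now apply H.
Qed.

Lemma holo_self_map_comp f g : holo_self_map f -> holo_self_map g ->
  holo_self_map (fun z => f (g z)).
Proof.
  rewrite !holo_self_map_cdiff. intros Hf Hg y Hy.
  destruct (Hg y Hy) as [H1 H2]. destruct (Hf _ H1) as [H3 H4].
  split; [exact H3|now apply cdiff_comp].
Qed.

Lemma holo_self_map_mob c : disk c -> holo_self_map (mob c).
Proof.
  intros Hc. apply holo_self_map_cdiff. intros y Hy.
  split; [now apply mob_disk|now apply cdiff_mob].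
Qed.

Lemma holo_self_map_rot l : Cmod l = 1 -> holo_self_map (fun z => l * z)%C.
Proof.
  intros Hl. apply holo_self_map_cdiff. intros y Hy. split.
  - unfold disk. now rewrite Cmod_mult, Hl, Rmult_1_l.
  - apply cdiff_mult; [apply cdiff_const|apply cdiff_id].
Qed.

Lemma holo_self_map_iter f n : holo_self_map f -> holo_self_map (fun z => Nat.iter n f z).
Proof.
  intros Hf. induction n as [|n IH].
  - apply holo_self_map_cdiff. intros y Hy. split; [exact Hy|apply cdiff_id].
  - exact (holo_self_map_comp f _ Hf IH).
Qed.

Lemma holo_bound f : holo_self_map f ->
  (forall y, disk y -> cdiff f y) /\ (forall y, disk y -> Cmod (f y) <= 1).
Proof.
  rewrite holo_self_map_cdiff. intros H. split; intros y Hy; [now apply H|].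
  left. now apply (H y Hy).
Qed.

Lemma iter_disk f n z : holo_self_map f -> disk z -> disk (Nat.iter n f z).
Proof. intros Hf. apply (holo_self_map_iter f n Hf). Qed.

Lemma conj_mul_unit l : Cmod l = 1 -> (Cconj l * l)%C = RtoC 1.
Proof. intros Hl. rewrite Cmult_comm, <- Cmod2_conj, Hl. f_equal. ring. Qed.

(** The general automorphism of the disk: it sends [b] to [a] and acts as the
    rotation by [l] in the coordinates centred at these points. *)
Definition mob_conj a l b (z : C) : C := mob (- a) (l * mob b z).

Lemma holo_self_map_mob_conj a l b : disk a -> disk b -> Cmod l = 1 ->
  holo_self_map (mob_conj a l b).
Proof.
  intros Ha Hb Hl.
  apply (holo_self_map_comp (mob (- a)) (fun z => l * mob b z)%C).
  - now apply holo_self_map_mob, disk_opp.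
  - apply (holo_self_map_comp (fun z => l * z)%C (mob b)).
    + now apply holo_self_map_rot.
    + now apply holo_self_map_mob.
Qed.

Lemma mob_conjK a l b z : disk a -> disk b -> Cmod l = 1 -> disk z ->
  mob_conj b (Cconj l) a (mob_conj a l b z) = z.
Proof.
  intros Ha Hb Hl Hz. unfold mob_conj.
  assert (Hw : disk (l * mob b z)).
  { apply (holo_self_map_rot l Hl). now apply mob_disk. }
  rewrite mobK' by assumption. rewrite Cmult_assoc, conj_mul_unit, Cmult_1_l by exact Hl.
  now apply mobK.
Qed.

Lemma mob_aut_exists a l b : disk a -> disk b -> Cmod l = 1 ->
  exists g : aut_disk, (forall z, aut_fun g z = mob_conj a l b z) /\
    (forall z, aut_inv g z = mob_conj b (Cconj l) a z).
Proof.
  intros Ha Hb Hl. assert (Hl' : Cmod (Cconj l) = 1) by now rewrite Cmod_conj.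
  unshelve eexists (AutDisk (mob_conj a l b) (mob_conj b (Cconj l) a) _ _ _ _).
  - now apply holo_self_map_mob_conj.
  - now apply holo_self_map_mob_conj.
  - intros z Hz. now apply mob_conjK.
  - intros z Hz. pose proof (mob_conjK b (Cconj l) a z Hb Ha Hl' Hz) as H.
    now rewrite Cconj_conj in H.
  - split; reflexivity.
Qed.

Lemma mob_conj_0 l c z : mob_conj 0 l c z = (l * mob c z)%C.
Proof.
  unfold mob_conj. set (w := (l * mob c z)%C). unfold mob.
  replace (Cconj (- 0)) with (RtoC 0) by (apply injective_projections; simpl; ring).
  replace (1 - 0 * w)%C with (RtoC 1) by ring. field.
Qed.

(** F is f read in the rotated coordinates centred at [c] and [f c]. *)
Lemma transition_map f c l l' : holo_self_map f -> disk c -> Cmod l = 1 -> Cmod l' = 1 ->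
  exists F, holo_self_map F /\ F (RtoC 0) = RtoC 0 /\
    forall z, disk z -> F (l * mob c z)%C = (l' * mob (f c) (f z))%C.
Proof.
  intros Hf Hc Hl Hl'. assert (Hcl : Cmod (Cconj l) = 1) by now rewrite Cmod_conj.
  pose proof (proj1 Hf c Hc) as Hfc.
  set (G := fun y => f (mob_conj c (Cconj l) 0 y)).
  assert (HG : holo_self_map G).
  { apply (holo_self_map_comp f); [exact Hf|].
    apply holo_self_map_mob_conj; auto. apply disk_0. }
  assert (HGE : forall z, disk z -> G (l * mob c z)%C = f z).
  { intros z Hz. unfold G. rewrite <- mob_conj_0, mob_conjK; auto. apply disk_0. }
  exists (fun y => mob_conj 0 l' (f c) (G y)). split; [|split].
  - apply (holo_self_map_comp (mob_conj 0 l' (f c)) G); [|exact HG].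
    apply holo_self_map_mob_conj; auto. apply disk_0.
  - replace (RtoC 0) with (l * mob c c)%C at 2 by (rewrite mob_0; ring).
    rewrite HGE by exact Hc. rewrite mob_conj_0, mob_0. ring.
  - intros z Hz. rewrite HGE by exact Hz. apply mob_conj_0.
Qed.

(** Recentring [f] at [b] and [f b] reduces to an automorphism fixing 0. *)
Lemma automorphism_mob_form f g b :
  holo_self_map f -> holo_self_map g ->
  (forall y, disk y -> g (f y) = y) -> disk b ->
  exists l, Cmod l = 1 /\ forall z, disk z -> mob (f b) (f z) = (l * mob b z)%C.
Proof.
  intros Hf Hg Hgf Hb.
  assert (Hfb : disk (f b)) by now apply Hf.
  set (F := fun y => mob (f b) (f (mob (- b) y))).
  set (G := fun y => mob b (g (mob (- f b) y))).
  assert (HF : holo_self_map F).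
  { apply (holo_self_map_comp (mob (f b)) (fun y => f (mob (- b) y)));
      [now apply holo_self_map_mob|].
    apply (holo_self_map_comp f); [exact Hf|]. now apply holo_self_map_mob, disk_opp. }
  assert (HG : holo_self_map G).
  { apply (holo_self_map_comp (mob b) (fun y => g (mob (- f b) y)));
      [now apply holo_self_map_mob|].
    apply (holo_self_map_comp g); [exact Hg|]. now apply holo_self_map_mob, disk_opp. }
  assert (EF : forall z, disk z -> F (mob b z) = mob (f b) (f z))
    by (intros z Hz; unfold F; now rewrite mobK).
  destruct (rotation_of_automorphism F G) as [l [Hl E]].
  - now apply holo_self_map_cdiff.
  - now apply holo_self_map_cdiff.
  - intros y Hy. unfold F, G.
    assert (Hy' : disk (mob (- b) y)) by (apply mob_disk; [now apply disk_opp|exact Hy]).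
    rewrite mobK by (auto; now apply Hf). rewrite Hgf by exact Hy'. now apply mobK'.
  - rewrite <- (mob_0 b) at 1. rewrite EF by exact Hb. apply mob_0.
  - exists l. split; [exact Hl|]. intros z Hz. rewrite <- EF by exact Hz.
    apply E. now apply mob_disk.
Qed.

(** * Existence of the normalized limit *)

Lemma unit_phase (u : C) : u <> RtoC 0 ->
  Cmod (Cconj u / Cmod u) = 1 /\ (Cconj u / Cmod u * u)%C = RtoC (Cmod u).
Proof.
  intros Hu. assert (Hm : 0 < Cmod u) by now apply Cmod_gt_0.
  assert (Hm' : RtoC (Cmod u) <> RtoC 0) by (intros e; apply RtoC_inj in e; lra).
  split.
  - rewrite Cmod_div, Cmod_conj, Cmod_R, Rabs_pos_eq by (exact Hm' || lra). field. lra.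
  - replace (Cconj u / Cmod u * u)%C with ((u * Cconj u) / Cmod u)%C by (field; exact Hm').
    rewrite <- Cmod2_conj. rewrite <- RtoC_div by lra. f_equal. field. lra.
Qed.

(** The iterate [f^n] followed by the Moebius map that brings the base point back
    to 0: the normalized iterate up to a rotation. *)
Definition centred (f : C -> C) (z0 : C) (n : nat) (z : C) : C :=
  mob (Nat.iter n f z0) (Nat.iter n f z).

Lemma centred_holo f z0 n l : holo_self_map f -> disk z0 -> Cmod l = 1 ->
  holo_self_map (fun z => l * centred f z0 n z)%C.
Proof.
  intros Hf Hz0 Hl.
  apply (holo_self_map_comp (fun z => l * z)%C (centred f z0 n)); [now apply holo_self_map_rot|].
  apply (holo_self_map_comp (mob (Nat.iter n f z0)) (fun z => Nat.iter n f z)).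
  - apply holo_self_map_mob. now apply iter_disk.
  - now apply holo_self_map_iter.
Qed.

Lemma centred_transition f z0 n l l' : holo_self_map f -> disk z0 ->
  Cmod l = 1 -> Cmod l' = 1 ->
  exists F, holo_self_map F /\ F (RtoC 0) = RtoC 0 /\
    forall z, disk z -> F (l * centred f z0 n z)%C = (l' * centred f z0 (S n) z)%C.
Proof.
  intros Hf Hz0 Hl Hl'.
  destruct (transition_map f (Nat.iter n f z0) l l') as (F & HF & HF0 & E); auto.
  { now apply iter_disk. }
  exists F. split; [exact HF|]. split; [exact HF0|]. intros z Hz.
  apply E. now apply iter_disk.
Qed.

Lemma centred_decr f z0 n z : holo_self_map f -> disk z0 -> disk z ->
  Cmod (centred f z0 (S n) z) <= Cmod (centred f z0 n z).
Proof.
  intros Hf Hz0 Hz.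
  destruct (centred_transition f z0 n 1 1 Hf Hz0 Cmod_1 Cmod_1) as (F & HF & HF0 & E).
  specialize (E z Hz). rewrite !Cmult_1_l in E. rewrite <- E.
  destruct (holo_bound F HF) as [H1 H2]. apply schwarz; auto.
  destruct (centred_holo f z0 n 1 Hf Hz0 Cmod_1) as [H3 _].
  specialize (H3 z Hz). now rewrite Cmult_1_l in H3.
Qed.

(** Once rotations are found for which the sequence converges at each point, the
    rest is automatic.  That [h] does not reach the unit circle is due to
    |h(z)| <= |u_0(z)|. *)
Lemma normalized_limit_exists f z0 (l : nat -> C) :
  holo_self_map f -> disk z0 -> (forall n, Cmod (l n) = 1) ->
  (forall z, disk z -> exists w, cv (fun n => (l n * centred f z0 n z)%C) w) ->
  exists (h : C -> C) (gamma : nat -> aut_disk),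
       holo_self_map h /\
       cvg_unif_compacts_disk (normalized_iterates f gamma) h /\
       (forall n : nat, normalized_iterates f gamma n z0 = RtoC 0) /\
       h z0 = RtoC 0.
Proof.
  intros Hf Hz0 Hl Hcv.
  set (g := fun n z => (l n * centred f z0 n z)%C).
  assert (Hg : forall n, holo_self_map (g n)) by (intros n; now apply centred_holo).
  destruct (functional_choice (fun n (gam : aut_disk) => forall z,
      normalized_iterates f (fun _ => gam) n z = g n z)) as [gamma Hgamma].
  { intros n.
    destruct (mob_aut_exists (Nat.iter n f z0) (Cconj (l n)) 0) as (gam & _ & Einv).
    - now apply iter_disk.
    - apply disk_0.
    - now rewrite Cmod_conj.
    - exists gam. intros z. unfold normalized_iterates.
      rewrite Einv, Cconj_conj. apply mob_conj_0. }
  assert (Hng : forall n z, normalized_iterates f gamma n z = g n z)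
    by (intros n z; exact (Hgamma n z)).
  destruct (functional_choice (fun z w => disk z -> cv (fun n => g n z) w)) as [h Hh].
  { intros z. destruct (classic (disk z)) as [Hz|Hz].
    - destruct (Hcv z Hz) as [w Hw]. now exists w.
    - exists (RtoC 0). tauto. }
  assert (Hgz0 : forall n, g n z0 = RtoC 0)
    by (intros n; unfold g, centred; rewrite mob_0; ring).
  exists h, gamma. split; [|split; [|split]].
  - apply holo_self_map_cdiff. intros y Hy. split.
    + apply Rle_lt_trans with (Cmod (g O y)); [|now apply (Hg O)].
      apply (cv_Cmod_le (fun n => g n y)); [now apply Hh|].
      intros n. unfold g. rewrite !Cmod_mult, !Hl, !Rmult_1_l.
      induction n as [|n IH]; [lra|]. eapply Rle_trans; [now apply centred_decr|exact IH].
    + apply (cdiff_limit g h); auto; intros n; apply (holo_bound (g n) (Hg n)).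
  - apply cvg_unif_compacts_of_pointwise.
    + intros n y Hy. apply cdiff_ext_loc with (g n) 1; [lra|auto|].
      now apply (holo_bound (g n) (Hg n)).
    + intros n y Hy. rewrite Hng. now apply (holo_bound (g n) (Hg n)).
    + intros y Hy. apply cv_ext with (fun n => g n y); [auto|]. now apply Hh.
  - intros n. rewrite Hng. apply Hgz0.
  - apply (cv_unique (fun n => g n z0)); [now apply Hh|].
    apply cv_ext with (fun _ => RtoC 0); [auto|apply cv_const].
Qed.

(** If |u_n(z1)| stays away from 0 for some z1, rotating its values to the positive
    axis forces convergence everywhere: the decrease of r_n = |u_n(z1)| controls
    all increments.  If there is no such z1, no rotation is needed. *)
Lemma based_limit_exists f z0 : holo_self_map f -> disk z0 ->
  exists (h : C -> C) (gamma : nat -> aut_disk),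
       holo_self_map h /\
       cvg_unif_compacts_disk (normalized_iterates f gamma) h /\
       (forall n : nat, normalized_iterates f gamma n z0 = RtoC 0) /\
       h z0 = RtoC 0.
Proof.
  intros Hf Hz0.
  set (u := centred f z0).
  assert (Hdecr : forall n z, disk z -> Cmod (u (S n) z) <= Cmod (u n z))
    by (intros n z Hz; now apply centred_decr).
  destruct (classic (exists z1 rho, disk z1 /\ 0 < rho /\ forall n, rho <= Cmod (u n z1)))
    as [(z1 & rho & Hz1 & Hrho & Hlow)|Hno].
  - assert (Hu1 : forall n, u n z1 <> RtoC 0)
      by (intros n; apply Cmod_gt_0; specialize (Hlow n); lra).
    set (l := fun n => (Cconj (u n z1) / Cmod (u n z1))%C).
    assert (Hl : forall n, Cmod (l n) = 1) by (intros n; now apply unit_phase).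
    set (r := fun n => Cmod (u n z1)).
    assert (Hr : forall n, (l n * u n z1)%C = RtoC (r n))
      by (intros n; now apply unit_phase).
    apply (normalized_limit_exists f z0 l Hf Hz0 Hl). intros z Hz. fold u.
    set (g := fun n y => (l n * u n y)%C).
    assert (Hg : forall n, holo_self_map (g n)) by (intros n; now apply centred_holo).
    (* pseudo-hyperbolic distances do not increase along the iterates, so d
       also bounds the distance from g n z to r n, for every n *)
    set (d := Cmod (mob z1 z)).
    assert (Hd : 0 <= d < 1).
    { split; [apply Cmod_ge_0|]. now apply (mob_disk z1 z). }
    assert (HK : 0 < (1 + d) / (1 - d)) by (apply Rdiv_lt_0_compat; lra).
    apply (telescoping_cv _ r ((1 + d) / (1 - d) / rho)).
    + intros n. change (Cmod (g (S n) z - g n z) <=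
        (1 + d) / (1 - d) / rho * (r n - r (S n))).
      destruct (centred_transition f z0 n (l n) (l (S n)) Hf Hz0 (Hl n) (Hl (S n)))
        as (F & HF & HF0 & E).
      fold u in E.
      assert (Er : F (RtoC (r n)) = RtoC (r (S n))).
      { rewrite <- Hr, <- Hr. now apply E. }
      assert (Eg : F (g n z) = g (S n) z) by now apply E.
      assert (Hrn : rho <= r n) by apply Hlow.
      assert (HrS : rho <= r (S n)) by apply Hlow.
      assert (HrD : r (S n) <= r n) by now apply Hdecr.
      assert (Hr1 : r n < 1).
      { pose proof (proj1 (Hg n) z1 Hz1) as H. unfold disk, g in H.
        rewrite Hr, Cmod_R, Rabs_pos_eq in H; lra. }
      set (q := r (S n) / r n).
      assert (Hq0 : q * r n = r (S n)) by (unfold q; field; lra).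
      assert (Hq : 0 <= q <= 1).
      { split.
        - left. apply Rdiv_lt_0_compat; lra.
        - apply Rmult_le_reg_r with (r n); lra. }
      destruct (holo_bound F HF) as [HF1 HF2].
      assert (Hst : Cmod (F (g n z) - g n z) <= (1 + d) / (1 - d) * (1 - q)).
      { apply (schwarz_stability F (r n) q (g n z) d); auto; try lra.
        - now rewrite Hq0.
        - now apply (Hg n).
        - destruct (holo_bound (g n) (Hg n)) as [Hg1 Hg2].
          pose proof (schwarz_pick (g n) z1 z Hg1 Hg2 Hz1 Hz) as HP.
          assert (Ez1 : g n z1 = RtoC (r n)) by apply Hr.
          rewrite Ez1 in HP.
          replace (Cconj (r n)) with (RtoC (r n)) in HP
            by (apply injective_projections; simpl; ring).
          pose proof (mob_den z1 z Hz1 Hz) as Hden.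
          unfold d, mob. rewrite Cmod_div by exact Hden.
          apply Cmod_gt_0 in Hden.
          apply Rmult_le_reg_r with (1 := Hden). eapply Rle_trans; [exact HP|].
          right. field. lra. }
      rewrite Eg in Hst. eapply Rle_trans; [exact Hst|].
      unfold Rdiv at 2. rewrite Rmult_assoc.
      apply Rmult_le_compat_l; [lra|].
      apply Rmult_le_reg_l with (1 := Hrho). rewrite <- Rmult_assoc, Rinv_r by lra.
      nra.
    + intros n. now apply Hdecr.
    + intros n. apply Cmod_ge_0.
    + now apply Rdiv_lt_0_compat.
  - apply (normalized_limit_exists f z0 (fun _ => RtoC 1)); auto; [intros; apply Cmod_1|].
    intros z Hz. exists (RtoC 0). intros eps He.
    assert (Hex : exists N, Cmod (u N z) < eps).
    { apply NNPP. intros Hn. apply Hno. exists z, eps. repeat split; auto.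
      intros n. apply Rnot_lt_le. intros Hlt. apply Hn. now exists n. }
    destruct Hex as [N HN]. exists N. intros n Hn.
    replace (1 * centred f z0 n z - 0)%C with (u n z) by (unfold u; ring).
    apply Rle_lt_trans with (2 := HN).
    induction Hn as [|n Hn IH]; [lra|].
    eapply Rle_trans; [now apply Hdecr|exact IH].
Qed.

(** * Uniqueness of the normalized limit *)

Lemma cv_mob (a b : nat -> C) x y : disk x -> disk y -> cv a x -> cv b y ->
  cv (fun n => mob (a n) (b n)) (mob x y).
Proof.
  intros Hx Hy Ha Hb. apply (cv_mult (fun n => b n - a n)%C).
  - now apply cv_minus.
  - apply (cv_inv (fun n => 1 - Cconj (a n) * b n)%C); [now apply mob_den|].
    apply cv_minus; [apply cv_const|]. apply cv_mult; [now apply cv_conj|exact Hb].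
Qed.

(** The automorphisms gamma_n^-1 o delta_n need not converge when [k] is
    constant, but then so is [h]; otherwise a point where [k] differs from k(0)
    determines the limit rotation. *)
Lemma limit_unique f h k (gamma delta : nat -> aut_disk) :
  holo_self_map f -> holo_self_map h -> holo_self_map k ->
  cvg_unif_compacts_disk (normalized_iterates f gamma) h ->
  cvg_unif_compacts_disk (normalized_iterates f delta) k ->
  exists phi : aut_disk, forall z, disk z -> h z = phi (k z).
Proof.
  intros Hf Hh Hk Hch Hck.
  set (hn := normalized_iterates f gamma). set (kn := normalized_iterates f delta).
  assert (Hh0 : disk (h (RtoC 0))) by now apply Hh, disk_0.
  assert (Hk0 : disk (k (RtoC 0))) by now apply Hk, disk_0.
  assert (Hkn : forall n z, disk z -> disk (kn n z)).
  { intros n z Hz. apply (aut_inv_holo (delta n)). now apply iter_disk. }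
  destruct (functional_choice (fun n l => Cmod l = 1 /\ forall z, disk z ->
     mob (hn n (RtoC 0)) (hn n z) = (l * mob (kn n (RtoC 0)) (kn n z))%C)) as [l Hl].
  { intros n.
    set (phi := fun y => aut_inv (gamma n) (aut_fun (delta n) y)).
    set (psi := fun y => aut_inv (delta n) (aut_fun (gamma n) y)).
    assert (Hphi : forall z, disk z -> phi (kn n z) = hn n z).
    { intros z Hz. unfold phi, kn, hn, normalized_iterates.
      now rewrite aut_invK by (now apply iter_disk). }
    destruct (automorphism_mob_form phi psi (kn n (RtoC 0))) as [l [Hl E]].
    - apply (holo_self_map_comp (aut_inv (gamma n))); [apply aut_inv_holo|apply aut_fun_holo].
    - apply (holo_self_map_comp (aut_inv (delta n))); [apply aut_inv_holo|apply aut_fun_holo].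
    - intros y Hy. unfold phi, psi.
      rewrite aut_invK by (now apply (aut_fun_holo (delta n))). now apply aut_funK.
    - apply Hkn, disk_0.
    - exists l. split; [exact Hl|]. intros z Hz.
      rewrite <- (Hphi z Hz), <- (Hphi _ disk_0). now apply E, Hkn. }
  set (A := fun z => mob (h (RtoC 0)) (h z)). set (V := fun z => mob (k (RtoC 0)) (k z)).
  set (An := fun n z => mob (hn n (RtoC 0)) (hn n z)).
  set (Vn := fun n z => mob (kn n (RtoC 0)) (kn n z)).
  assert (HA : forall z, disk z -> cv (fun n => An n z) (A z)).
  { intros z Hz. apply cv_mob; auto; [now apply Hh| |].
    - now apply (cv_of_cvg_unif_compacts hn h 0 Hch), disk_0.
    - now apply (cv_of_cvg_unif_compacts hn h z Hch). }
  assert (HV : forall z, disk z -> cv (fun n => Vn n z) (V z)).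
  { intros z Hz. apply cv_mob; auto; [now apply Hk| |].
    - now apply (cv_of_cvg_unif_compacts kn k 0 Hck), disk_0.
    - now apply (cv_of_cvg_unif_compacts kn k z Hck). }
  assert (EAV : forall n z, disk z -> An n z = (l n * Vn n z)%C) by (intros n; apply Hl).
  assert (Hmod : forall z, disk z -> Cmod (A z) = Cmod (V z)).
  { intros z Hz. apply (cv_Cmod_eq (fun n => An n z) (fun n => Vn n z)); auto.
    intros n. rewrite EAV by exact Hz. rewrite Cmod_mult, (proj1 (Hl n)). ring. }
  assert (Hex : exists lam, Cmod lam = 1 /\ forall z, disk z -> A z = (lam * V z)%C).
  { destruct (classic (exists z1, disk z1 /\ V z1 <> RtoC 0)) as [[z1 [Hz1 Hne]]|Hno].
    - exists (A z1 / V z1)%C. split.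
      + rewrite Cmod_div, Hmod by assumption. field.
        apply Cmod_gt_0 in Hne. lra.
      + intros z Hz.
        (* true at each n, both sides having the same factor l n *)
        assert (Ec : (A z * V z1)%C = (A z1 * V z)%C).
        { apply (cv_unique (fun n => An n z * Vn n z1)%C).
          - apply cv_mult; auto.
          - apply cv_ext with (fun n => An n z1 * Vn n z)%C.
            + intros n. rewrite !EAV by assumption. ring.
            + apply cv_mult; auto. }
        replace (A z) with (A z * V z1 / V z1)%C by (field; exact Hne).
        rewrite Ec. field. exact Hne.
    - exists (RtoC 1). split; [apply Cmod_1|]. intros z Hz.
      assert (EV : V z = RtoC 0) by (apply NNPP; intros Hn; apply Hno; now exists z).
      rewrite EV, Cmult_0_r. apply Cmod_eq_0. rewrite Hmod, EV by exact Hz. apply Cmod_0. }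
  destruct Hex as [lam [Hlam E]].
  destruct (mob_aut_exists (h (RtoC 0)) lam (k (RtoC 0)) Hh0 Hk0 Hlam) as [phi [Ephi _]].
  exists phi. intros z Hz. rewrite Ephi. unfold mob_conj.
  change (mob (k (RtoC 0)) (k z)) with (V z). rewrite <- E by exact Hz.
  symmetry. apply mobK; [exact Hh0|now apply Hh].
Qed.

Theorem theorem2 (f : C -> C) (hf : holo_self_map f) :
  (exists (h : C -> C) (gamma : nat -> aut_disk),
     holo_self_map h /\
     cvg_unif_compacts_disk (normalized_iterates f gamma) h) /\
  (forall (h k : C -> C) (gamma delta : nat -> aut_disk),
     holo_self_map h -> holo_self_map k ->
     cvg_unif_compacts_disk (normalized_iterates f gamma) h ->
     cvg_unif_compacts_disk (normalized_iterates f delta) k ->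
     exists phi : aut_disk, forall z : C, disk z -> h z = phi (k z)) /\
  (forall z0 : C, disk z0 ->
     exists (h : C -> C) (gamma : nat -> aut_disk),
       holo_self_map h /\
       cvg_unif_compacts_disk (normalized_iterates f gamma) h /\
       (forall n : nat, normalized_iterates f gamma n z0 = RtoC 0) /\
       h z0 = RtoC 0).
Proof.
  split; [|split].
  - destruct (based_limit_exists f 0 hf disk_0) as (h & gamma & H1 & H2 & _).
    now exists h, gamma.
  - intros h k gamma delta. now apply limit_unique.
  - intros z0 Hz0. now apply based_limit_exists.
Qed.
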